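(* Let $\{H_n\}$ be a sequence of matrices with each $H_n$ an $n\times n$ Hermitian matrix whose spectrum is contained in $[-1,1]$. Fix real $\mu$, $\beta>0$, let $F_n=\big[I_n+e^{\beta(H_n-\mu I_n)}\big]^{-1}$, and let $\bar\chi$, $c=c(\chi)$, $M(\chi)$ be as follows: $\bar\chi$ is given by $$\bar\chi=\frac{\sqrt{\sqrt{(\beta^2(1-\mu^2)-\pi^2)^2+4\pi^2\beta^2}-\beta^2(1-\mu^2)+\pi^2}}{\sqrt2\,\beta}+\frac{\sqrt{\sqrt{(\beta^2(1-\mu^2)-\pi^2)^2+4\pi^2\beta^2}+\beta^2(1+\mu^2)+\pi^2}}{\sqrt2\,\beta},$$ and $c=2\chi M(\chi)/(\chi-1)$ with $M(\chi)=\max_{z\in\mathcal E_\chi}|1/(1+e^{\beta(z-\mu)})|$. Then for every $1<\chi<\bar\chi$, with $\theta=\ln\chi$, $$|[F_n]_{ij}|\le c\,e^{-\theta\, d_n(i,j)}\quad\text{for all } i\ne j \text{ and all } n.$$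
   Context: For $\chi>1$, $\mathcal E_\chi$ is the ellipse with foci $\pm1$ whose semi-axes sum to $\chi$. $d_n(i,j)$ is the geodetic distance between $i$ and $j$ in the graph $G_n$ associated with $H_n$: vertices $\{1,\dots,n\}$, with an edge between $i\ne j$ iff $[H_n]_{ij}\neq0$; $d_n(i,j)=+\infty$ (and $e^{-\infty}=0$) if $i$ and $j$ are not connected. *)

(* Defs.v *)
From Stdlib Require Import Reals Lra Factorial.
Open Scope R_scope.

Record C := mkC { re : R ; im : R }.

Definition C0 : C := mkC 0 0.
Definition C1 : C := mkC 1 0.
Definition RtoC (x : R) : C := mkC x 0.
Definition Cadd (z w : C) : C := mkC (re z + re w) (im z + im w).
Definition Copp (z : C) : C := mkC (- re z) (- im z).
Definition Csub (z w : C) : C := Cadd z (Copp w).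
Definition Cmul (z w : C) : C :=
  mkC (re z * re w - im z * im w) (re z * im w + im z * re w).
Definition Cconj (z : C) : C := mkC (re z) (- im z).
Definition Cnorm (z : C) : R := sqrt (re z * re z + im z * im z).
Definition Cinv (z : C) : C :=
  let d := re z * re z + im z * im z in mkC (re z / d) (- im z / d).
Definition Cexp (z : C) : C := mkC (exp (re z) * cos (im z)) (exp (re z) * sin (im z)).

Fixpoint Csum (n : nat) (f : nat -> C) : C :=
  match n with O => C0 | S m => Cadd (Csum m f) (f m) end.

(** * n x n complex matrices, represented as functions on indices 0..n-1 *)
Definition Mat := nat -> nat -> C.

Definition mid : Mat := fun i j => if Nat.eqb i j then C1 else C0.
Definition madd (A B : Mat) : Mat := fun i j => Cadd (A i j) (B i j).
Definition msub (A B : Mat) : Mat := fun i j => Csub (A i j) (B i j).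
Definition mscale (a : C) (A : Mat) : Mat := fun i j => Cmul a (A i j).
Definition mmul (n : nat) (A B : Mat) : Mat :=
  fun i j => Csum n (fun k => Cmul (A i k) (B k j)).
Fixpoint mpow (n : nat) (A : Mat) (k : nat) : Mat :=
  match k with O => mid | S k' => mmul n A (mpow n A k') end.

Definition meq (n : nat) (A B : Mat) : Prop :=
  forall i j, (i < n)%nat -> (j < n)%nat -> A i j = B i j.

Definition hermitian (n : nat) (A : Mat) : Prop :=
  forall i j, (i < n)%nat -> (j < n)%nat -> A i j = Cconj (A j i).

Definition eigenvalue (n : nat) (A : Mat) (lam : C) : Prop :=
  exists v : nat -> C,
    (exists i, (i < n)%nat /\ v i <> C0) /\
    forall i, (i < n)%nat -> Csum n (fun k => Cmul (A i k) (v k)) = Cmul lam (v i).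

Definition spectrum_in_m11 (n : nat) (A : Mat) : Prop :=
  forall lam, eigenvalue n A lam -> im lam = 0 /\ -1 <= re lam <= 1.

Definition mexp_partial (n : nat) (A : Mat) (N : nat) : Mat :=
  fun i j => Csum (S N) (fun k => Cmul (RtoC (/ INR (fact k))) (mpow n A k i j)).
Definition is_mexp (n : nat) (A E : Mat) : Prop :=
  forall i j, (i < n)%nat -> (j < n)%nat ->
    Un_cv (fun N => re (mexp_partial n A N i j)) (re (E i j)) /\
    Un_cv (fun N => im (mexp_partial n A N i j)) (im (E i j)).

Definition is_minv (n : nat) (B F : Mat) : Prop :=
  meq n (mmul n B F) mid /\ meq n (mmul n F B) mid.

Definition gedge (n : nat) (A : Mat) (i j : nat) : Prop :=
  (i < n)%nat /\ (j < n)%nat /\ i <> j /\ A i j <> C0.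

Inductive walk (n : nat) (A : Mat) : nat -> nat -> nat -> Prop :=
| walk0 : forall i, (i < n)%nat -> walk n A 0 i i
| walkS : forall k i l j, gedge n A i l -> walk n A k l j -> walk n A (S k) i j.

Definition is_gdist (n : nat) (A : Mat) (i j d : nat) : Prop :=
  walk n A d i j /\ forall m, (m < d)%nat -> ~ walk n A m i j.

(** i and j are not connected: d_n(i,j) = +infinity *)
Definition disconnected (n : nat) (A : Mat) (i j : nat) : Prop :=
  forall m, ~ walk n A m i j.

Definition chibar (beta mu : R) : R :=
  let s := sqrt ((beta^2 * (1 - mu^2) - PI^2)^2 + 4 * PI^2 * beta^2) in
  sqrt (s - beta^2 * (1 - mu^2) + PI^2) / (sqrt 2 * beta)
  + sqrt (s + beta^2 * (1 + mu^2) + PI^2) / (sqrt 2 * beta).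

Definition fermi (beta mu : R) (z : C) : C :=
  Cinv (Cadd C1 (Cexp (Cmul (RtoC beta) (Csub z (RtoC mu))))).

(** the ellipse E_chi with foci +-1 and semi-axes summing to chi:
    semi-axes a = (chi + 1/chi)/2, b = (chi - 1/chi)/2 *)
Definition ellipse (chi : R) (z : C) : Prop :=
  exists t : R, z = mkC ((chi + / chi) / 2 * cos t) ((chi - / chi) / 2 * sin t).

(** the set { |fermi z| : z in E_chi }; M(chi) is its maximum (lub) *)
Definition fermi_mod_set (beta mu chi : R) (y : R) : Prop :=
  exists z, ellipse chi z /\ y = Cnorm (fermi beta mu z).

(* Main.v *)
Require Import Defs.
From Stdlib Require Import Reals Lra Psatz.
Open Scope R_scope.

(** The function f(z) = 1 / (1 + exp (beta (z - mu))) is a uniform limit of polynomials p on the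
    union of the ellipse and [-1, 1]: the poles of 1 / (1 + exp (s beta (z - mu))) come from
    infinity as s grows from 0 to 1 and never enter the closed ellipse when chi < chibar, so
    finitely many Neumann series lead from the constant 1/2 to f.  For a polynomial
    p = sum a_k T_k, averaging over equidistributed points of the ellipse gives
    |a_k| <= 2 chi^-k max |p|, with no complex integration; truncating the Chebyshev expansion at
    degree d then costs at most 2 chi max |p| / (chi - 1) * chi^-d on [-1, 1].  By the spectral
    theorem |F_ij - q(H)_ij| is at most the distance of f and q on [-1, 1], and q(H)_ij = 0 when
    q has degree less than the distance of i and j. *)

(** * Real estimates *)

(** Holomorphy is replaced by membership in the uniform closure of the polynomials on a set [K],
    here the curve together with the segment. The curve carries the bound [M], the segment carries
    the spectrum, and no maximum principle is invoked to pass from one to the other, so a single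
    polynomial has to be close to f on both. The closure is stable under sums, bounded products and
    exp, but a function without zeros on [K] need not have its inverse there: 1/z on the unit circle
    is no uniform limit of polynomials. Hence the path in s, along which 1 + exp stays uniformly
    away from 0; this is where [chi < chibar beta mu] enters, through real inequalities only. The
    factor 2 chi / (chi - 1) of c is the geometric sum 2 (1 + chi^-1 + chi^-2 + ...) of the
    coefficient bounds. The approximation error enlarges M slightly and disappears in the limit. *)

Lemma cos_sin_sq (t : R) : cos t * cos t + sin t * sin t = 1.
Proof. generalize (sin2_cos2 t); unfold Rsqr; lra. Qed.

(** From above: exp (-x) >= 1 - x gives exp x <= 1 / (1 - x), and 1 <= (1 + x + 2 x^2) (1 - x) when
    |x| <= 1/2. *)
Lemma exp_second_order (x : R) :
  Rabs x <= / 2 -> - (2 * (x * x)) <= exp x - 1 - x <= 2 * (x * x).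
Proof.
intros hx.
assert (-/2 <= x <= /2) by (split; unfold Rabs in hx; destruct (Rcase_abs x); lra).
generalize (exp_ineq1_le x) (exp_ineq1_le (-x)) (exp_pos x); intros h0 h1 h2.
assert (h3 : exp x * exp (-x) = 1).
{ rewrite <- exp_plus, Rplus_opp_r; apply exp_0. }
split; [nra|].
assert (h4 : exp x * (1 - x) <= 1) by nra.
assert (1 <= (1 + x + 2 * (x * x)) * (1 - x)) by nra.
nra.
Qed.

Lemma sin_sq_le (y : R) : sin y * sin y <= y * y.
Proof.
assert (h : forall t, 0 < t -> sin t * sin t <= t * t).
{ intros t ht. generalize (sin_lt_x t ht) (SIN_bound t); intros h1 h2.
  destruct (Rle_dec t 1) as [h3|h3].
  - assert (0 <= sin t) by (apply sin_ge_0; generalize PI2_1; lra). nra.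
  - nra. }
destruct (Rtotal_order y 0) as [hy|[->|hy]].
- generalize (h (-y) ltac:(lra)). rewrite sin_neg. lra.
- rewrite sin_0; lra.
- auto.
Qed.

Lemma cos_second_order (y : R) : - (y * y / 2) <= cos y - 1 <= 0.
Proof.
generalize (COS_bound y) (sin_sq_le (y / 2)); intros h1 h2.
replace (cos y) with (1 - 2 * sin (y / 2) * sin (y / 2)); [nra|].
rewrite <- cos_2a_sin; f_equal; lra.
Qed.

Lemma sin_second_order (y : R) :
  Rabs y <= / 2 -> - (y * y) <= sin y - y <= y * y.
Proof.
intros hy.
assert (h : forall t, 0 <= t <= /2 -> - (t * t) <= sin t - t <= 0).
{ intros t ht. split.
  - destruct (pre_sin_bound t 0 ltac:(lra) ltac:(lra)) as [h _].
    unfold sin_approx, sin_term in h; simpl in h. nra.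
  - destruct (Rtotal_order t 0) as [h|[->|h]]; [lra|rewrite sin_0; lra|].
    generalize (sin_lt_x t h); lra. }
unfold Rabs in hy; destruct (Rcase_abs y) as [h1|h1].
- generalize (h (-y) ltac:(lra)). rewrite sin_neg. lra.
- generalize (h y ltac:(lra)). nra.
Qed.

(** The real form of |e^w - 1 - w| <= 8 |w|^2 with w = x + iy, squared so that no root occurs. Each
    coordinate is at most 4 |w|^2 in absolute value. *)
Lemma cexp_second_order (x y : R) :
  x * x + y * y <= / 4 ->
  (exp x * cos y - 1 - x) * (exp x * cos y - 1 - x)
  + (exp x * sin y - y) * (exp x * sin y - y)
  <= (8 * (x * x + y * y)) * (8 * (x * x + y * y)).
Proof.
intros h.
assert (hx : Rabs x <= /2) by (apply Rabs_le; split; nra).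
assert (hy : Rabs y <= /2) by (apply Rabs_le; split; nra).
generalize (exp_second_order x hx) (cos_second_order y) (sin_second_order y hy)
  (exp_pos x); intros e c s p.
assert (bx : -/2 <= x <= /2) by (split; nra).
assert (hy' : -/2 <= y <= /2) by (split; nra).
assert (e2 : exp x <= 2) by nra.
assert (A1 : Rabs (exp x * cos y - 1 - x) <= 4 * (x * x + y * y)).
{ replace (exp x * cos y - 1 - x) with ((exp x - 1 - x) + exp x * (cos y - 1)) by ring.
  apply Rabs_le; split; nra. }
assert (A2 : Rabs (exp x * sin y - y) <= 4 * (x * x + y * y)).
{ replace (exp x * sin y - y)
    with (exp x * (sin y - y) + (exp x - 1 - x) * y + x * y) by ring.
  assert (a1 : - (2 * (y * y)) <= exp x * (sin y - y) <= 2 * (y * y)) by (split; nra).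
  assert (a2 : - (x * x) <= (exp x - 1 - x) * y <= x * x) by (split; nra).
  assert (a3 : - ((x * x + y * y) / 2) <= x * y <= (x * x + y * y) / 2).
  { generalize (Rle_0_sqr (x - y)) (Rle_0_sqr (x + y)); unfold Rsqr; lra. }
  generalize (Rle_0_sqr x) (Rle_0_sqr y); unfold Rsqr; intros.
  apply Rabs_le; split; lra. }
assert (sq : forall u v, Rabs u <= v -> u * u <= v * v).
{ intros u v hu. unfold Rabs in hu; destruct (Rcase_abs u); nra. }
generalize (sq _ _ A1) (sq _ _ A2); intros q1 q2.
assert (0 <= x * x + y * y) by nra.
nra.
Qed.

(* [chibar] is the sum of the semi-axes of the ellipse through the pole [mu + i PI / beta]. *)
Lemma pole_outside (beta mu chi : R) :
  0 < beta -> 1 < chi < chibar beta mu ->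
  let a := (chi + / chi) / 2 in let b := (chi - / chi) / 2 in
  1 < mu * mu / (a * a) + (PI / beta) * (PI / beta) / (b * b).
Proof.
intros hb [h1 h2] a b.
set (p := PI / beta).
assert (hp : 0 < p) by (apply Rdiv_lt_0_compat; [apply PI_RGT_0|lra]).
assert (hs2 : sqrt 2 * sqrt 2 = 2) by (apply sqrt_sqrt; lra).
assert (hs2p : 0 < sqrt 2) by (apply sqrt_lt_R0; lra).
(* [A] and [B] below are the semi-axes of the ellipse with foci -1 and 1 through the pole mu + ip:
   eliminating B from A^2 - B^2 = 1 and mu^2 / A^2 + p^2 / B^2 = 1 leaves a quadratic equation for
   A^2 with discriminant D^2. *)
set (S := mu * mu + p * p).
set (D := sqrt ((S - 1) * (S - 1) + 4 * (p * p))).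
assert (hpi : PI = p * beta) by (unfold p; field; lra).
assert (HD : 0 <= (S - 1) * (S - 1) + 4 * (p * p)).
{ generalize (Rle_0_sqr (S - 1)) (Rle_0_sqr p); unfold Rsqr; lra. }
assert (hD : D * D = (S - 1) * (S - 1) + 4 * (p * p)) by (apply sqrt_sqrt; exact HD).
assert (hD0 : 0 <= D) by apply sqrt_pos.
assert (hDS : Rabs (S - 1) < D).
{ apply Rsqr_incrst_0; [|apply Rabs_pos|exact hD0].
  rewrite <- Rsqr_abs. unfold Rsqr. nra. }
assert (hDb : 1 - S < D /\ S - 1 < D).
{ unfold Rabs in hDS; destruct (Rcase_abs (S - 1)); lra. }
set (A := sqrt ((D + 1 + S) / 2)). set (B := sqrt ((D - 1 + S) / 2)).
assert (hA : A * A = (D + 1 + S) / 2) by (apply sqrt_sqrt; unfold S in *; nra).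
assert (hB : B * B = (D - 1 + S) / 2) by (apply sqrt_sqrt; lra).
assert (hA0 : 0 < A) by (apply sqrt_lt_R0; unfold S in *; nra).
assert (hB0 : 0 < B) by (apply sqrt_lt_R0; lra).
assert (hsc : forall u v, 0 <= v -> u = 2 * beta * beta * v -> sqrt u / (sqrt 2 * beta) = sqrt v).
{ intros u v hv ->.
  replace (2 * beta * beta * v) with ((sqrt 2 * beta) * (sqrt 2 * beta) * v)
    by (replace 2 with (sqrt 2 * sqrt 2) at 3 by exact hs2; ring).
  rewrite sqrt_mult by nra. rewrite sqrt_square by nra. field. split; lra. }
assert (hchi : chibar beta mu = B + A).
{ unfold chibar.
  assert (hs : sqrt ((beta ^ 2 * (1 - mu ^ 2) - PI ^ 2) ^ 2 + 4 * PI ^ 2 * beta ^ 2)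
    = beta * beta * D).
  { replace ((beta ^ 2 * (1 - mu ^ 2) - PI ^ 2) ^ 2 + 4 * PI ^ 2 * beta ^ 2)
      with ((beta * beta) * (beta * beta) * ((S - 1) * (S - 1) + 4 * (p * p)))
      by (rewrite hpi; unfold S; ring).
    rewrite sqrt_mult by nra. rewrite sqrt_square by nra. reflexivity. }
  rewrite hs. f_equal; apply hsc; unfold S in *; try nra; rewrite hpi; field. }
assert (hAB : A * A - B * B = 1) by lra.
assert (hi : chi * / chi = 1) by (field; lra).
set (r := / chi) in *.
assert (hr : 0 < r < 1) by (split; [apply Rinv_0_lt_compat; lra|nra]).
assert (hab : a * a - b * b = 1) by (unfold a, b; nra).
assert (hb0 : 0 < b) by (unfold b; lra).
assert (ha0 : 0 < a) by (unfold a; lra).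
assert (sum_lt : a + b < A + B) by (unfold a, b; lra).
(* Since a - b = 1 / (a + b), a smaller sum of the semi-axes means a larger difference, hence a
   smaller [b]. *)
assert (b_lt : b < B) by nra.
assert (a_lt : a < A) by nra.
assert (on : mu * mu * (B * B) + p * p * (A * A) = (A * A) * (B * B)).
{ rewrite hA, hB. unfold S in *. nra. }
assert (on' : mu * mu / (A * A) + p * p / (B * B) = 1).
{ apply Rmult_eq_reg_r with ((A * A) * (B * B)); [|nra].
  rewrite Rmult_1_l. apply eq_trans with (2 := on). field. split; lra. }
assert (i1 : mu * mu / (A * A) <= mu * mu / (a * a)).
{ apply Rmult_le_compat_l; [nra|]. apply Rinv_le_contravar; nra. }
(* Strictness comes from this term, because p > 0 while mu may vanish. *)
assert (i2 : p * p / (B * B) < p * p / (b * b)).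
{ apply Rmult_lt_compat_l; [nra|]. apply Rinv_lt_contravar; [repeat apply Rmult_lt_0_compat; lra|nra]. }
lra.
Qed.

(** * The closed elliptic region and a uniform lower bound for |1 + exp (s beta (z - mu))| on it *)

Definition semi_axis_x (chi : R) := (chi + / chi) / 2.
Definition semi_axis_y (chi : R) := (chi - / chi) / 2.

Definition solid_ellipse (chi x y : R) : Prop :=
  x * x / (semi_axis_x chi * semi_axis_x chi)
  + y * y / (semi_axis_y chi * semi_axis_y chi) <= 1.

Lemma cos_near_pi (eta Y : R) : 0 < eta <= 1 -> Rabs Y <= PI - eta -> - cos eta <= cos Y.
Proof.
intros he hY. generalize PI2_1; intros h1.
replace (- cos eta) with (cos (PI - eta)).
2:{ rewrite cos_minus, cos_PI, sin_PI; ring. }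
replace (cos Y) with (cos (Rabs Y)).
2:{ unfold Rabs; destruct (Rcase_abs Y); [apply cos_neg|reflexivity]. }
generalize (Rabs_pos Y); intros; apply cos_decr_1; lra.
Qed.

(* If [s beta (x - mu) = X] is small and [s beta y = Y] is at least [PI - eta] in absolute
   value, then [(x, y)] is close to or beyond the pole and so outside the ellipse. *)
Lemma one_plus_cexp_bounded_below (beta mu chi : R) :
  0 < beta -> 1 < chi < chibar beta mu ->
  exists delta, 0 < delta /\ forall s x y, 0 <= s <= 1 -> solid_ellipse chi x y ->
    let X := s * (beta * (x - mu)) in let Y := s * (beta * y) in
    delta <= (1 + exp X * cos Y) * (1 + exp X * cos Y)
             + (exp X * sin Y) * (exp X * sin Y).
Proof.
intros hb hc. pose proof (pole_outside beta mu chi hb hc) as hk; cbv zeta in hk.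
destruct hc as [h1 _].
assert (hi : chi * / chi = 1) by (field; lra).
assert (hr : 0 < / chi < 1).
{ split; [apply Rinv_0_lt_compat; lra|].
  rewrite <- Rinv_1. apply Rinv_lt_contravar; lra. }
unfold solid_ellipse, semi_axis_x, semi_axis_y.
set (a := (chi + / chi) / 2) in *. set (b := (chi - / chi) / 2) in *.
assert (ha : 0 < a) by (unfold a; lra).
assert (hb0 : 0 < b) by (unfold b; lra).
set (kappa := mu * mu / (a * a) + PI / beta * (PI / beta) / (b * b)) in *.
set (ia := / (a * a)). set (ib := / (b * b)).
assert (hia : 0 < ia) by (apply Rinv_0_lt_compat; nra).
assert (hib : 0 < ib) by (apply Rinv_0_lt_compat; nra).
generalize PI2_1 PI_4; intros hpi hpi4.
(* If |x - mu| <= eta b and |y| >= (PI - eta) / beta, then x^2 / a^2 + y^2 / b^2 >= kappa - eta L: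
   the first two summands of [L] are the coefficients of eta in the two squares, and the summand 1
   secures 0 < L. So eta L < kappa - 1 puts the point outside the ellipse. *)
set (L := 2 * Rabs mu * b * ia + 2 * PI / (beta * beta) * ib + 1).
assert (hibb : 0 < / (beta * beta)) by (apply Rinv_0_lt_compat; nra).
assert (hL : 0 < L).
{ unfold L. generalize (Rabs_pos mu); intros hm.
  assert (0 <= 2 * Rabs mu * b * ia) by (repeat apply Rmult_le_pos; lra).
  assert (0 <= 2 * PI / (beta * beta) * ib) by
    (apply Rmult_le_pos; [apply Rlt_le, Rdiv_lt_0_compat; nra|lra]).
  lra. }
set (eta := Rmin 1 ((kappa - 1) / (2 * L))).
assert (he : 0 < eta) by (apply Rmin_pos; [lra|apply Rdiv_lt_0_compat; lra]).
assert (he1 : eta <= 1) by apply Rmin_l.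
assert (he2 : eta * L < kappa - 1).
{ apply Rle_lt_trans with ((kappa - 1) / (2 * L) * L).
  - apply Rmult_le_compat_r; [lra|apply Rmin_r].
  - replace ((kappa - 1) / (2 * L) * L) with ((kappa - 1) / 2) by (field; lra). lra. }
assert (hd1 : 0 < 1 - exp (- eta)).
{ rewrite <- exp_0 at 1. generalize (exp_increasing (-eta) 0 ltac:(lra)). lra. }
assert (hd2 : 0 < sin eta) by (apply sin_gt_0; lra).
(* One bound per case: |1 + e^(X + iY)| is always at least |e^X - 1|, and it is at least sin eta
   when cos Y >= - cos eta, by completing the square in e^X. *)
set (d := Rmin (1 - exp (- eta)) (sin eta)).
assert (hd : 0 < d) by (apply Rmin_pos; lra).
exists (d * d). split; [nra|].
intros s x y hs hxy.
set (X := s * (beta * (x - mu))). set (Y := s * (beta * y)).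
generalize (cos_sin_sq Y) (exp_pos X); intros hcs hexp.
replace ((1 + exp X * cos Y) * (1 + exp X * cos Y) + exp X * sin Y * (exp X * sin Y))
  with (1 + 2 * exp X * cos Y + exp X * exp X * (cos Y * cos Y + sin Y * sin Y)) by ring.
rewrite hcs.
destruct (Rle_dec eta (Rabs X)) as [hX|hX].
- assert (hdX : d <= Rabs (exp X - 1)).
  { apply Rle_trans with (1 := Rmin_l _ _).
    unfold Rabs in hX; destruct (Rcase_abs X) as [nX|nX].
    - rewrite Rabs_left.
      + assert (exp X <= exp (- eta)); [|lra].
        destruct (Req_dec X (- eta)) as [->|ne]; [lra|].
        left; apply exp_increasing; lra.
      + rewrite <- exp_0. generalize (exp_increasing X 0 nX); lra.
    - generalize (exp_ineq1_le X) (exp_ineq1_le (- eta)); intros.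
      rewrite Rabs_right; lra. }
  assert (d * d <= (exp X - 1) * (exp X - 1)).
  { unfold Rabs in hdX; destruct (Rcase_abs (exp X - 1)); nra. }
  generalize (COS_bound Y); nra.
- destruct (Rle_dec (Rabs Y) (PI - eta)) as [hY|hY].
  + generalize (cos_near_pi eta Y ltac:(lra) hY) (cos_sin_sq eta) (Rmin_r (1 - exp (- eta)) (sin eta)).
    fold d. intros c1 c2 c3.
    assert (d * d <= sin eta * sin eta) by nra.
    generalize (Rle_0_sqr (exp X - cos eta)); unfold Rsqr; intros c4.
    nra.
  + exfalso. apply Rnot_le_lt in hX, hY.
    assert (aY : Rabs Y = s * beta * Rabs y).
    { unfold Y. rewrite !Rabs_mult, (Rabs_right s), (Rabs_right beta) by lra. ring. }
    assert (aX : Rabs X = s * beta * Rabs (x - mu)).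
    { unfold X. rewrite !Rabs_mult, (Rabs_right s), (Rabs_right beta) by lra. ring. }
    generalize (Rabs_pos y) (Rabs_pos (x - mu)) (Rabs_pos mu); intros py pxm pmu.
    assert (yy : y * y = Rabs y * Rabs y) by (unfold Rabs; destruct (Rcase_abs y); ring).
    assert (hyb : Rabs y <= b).
    { assert (y * y * ib <= 1).
      { assert (0 <= x * x * ia) by (apply Rmult_le_pos; [apply Rle_0_sqr|lra]).
        unfold Rdiv in hxy. fold ia ib in hxy. lra. }
      assert (bb : b * b * ib = 1) by (unfold ib; field; lra).
      assert (y * y <= b * b) by (apply Rmult_le_reg_r with ib; lra).
      apply Rsqr_incr_0; [unfold Rsqr|..]; lra. }
    assert (sb : 0 <= s * beta) by nra.
    (* As |Y| > PI - eta >= 1 and |y| <= b, the parameter s cannot be small; this is what turns |X|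
       < eta into closeness of x to mu. *)
    assert (sbb : 1 <= s * beta * b).
    { assert (s * beta * Rabs y <= s * beta * b) by (apply Rmult_le_compat_l; lra). lra. }
    assert (hxm : Rabs (x - mu) <= eta * b).
    { apply Rnot_lt_le; intros hlt.
      assert (s * beta * (eta * b) <= s * beta * Rabs (x - mu)) by (apply Rmult_le_compat_l; lra).
      assert (eta * 1 <= eta * (s * beta * b)) by (apply Rmult_le_compat_l; lra).
      lra. }
    assert (hx2 : mu * mu - 2 * Rabs mu * b * eta <= x * x).
    { assert (- (Rabs mu * Rabs (x - mu)) <= mu * (x - mu)).
      { rewrite <- Rabs_mult. unfold Rabs; destruct (Rcase_abs (mu * (x - mu))); lra. }
      assert (Rabs mu * Rabs (x - mu) <= Rabs mu * (eta * b)) by (apply Rmult_le_compat_l; lra).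
      generalize (Rle_0_sqr (x - mu)); unfold Rsqr; intros; lra. }
    assert (hy2 : PI / beta * (PI / beta) - 2 * PI / (beta * beta) * eta <= y * y).
    { apply Rmult_le_reg_l with (beta * beta); [nra|].
      replace (beta * beta * (PI / beta * (PI / beta) - 2 * PI / (beta * beta) * eta))
        with (PI * PI - 2 * PI * eta) by (field; lra).
      assert (PI - eta <= beta * Rabs y).
      { assert (s * (beta * Rabs y) <= 1 * (beta * Rabs y)).
        { apply Rmult_le_compat_r; [apply Rmult_le_pos|]; lra. }
        lra. }
      assert ((PI - eta) * (PI - eta) <= (beta * Rabs y) * (beta * Rabs y))
        by (apply Rmult_le_compat; lra).
      generalize (Rle_0_sqr eta); unfold Rsqr; intros. rewrite yy. lra. }
    assert (q1 : (mu * mu - 2 * Rabs mu * b * eta) * ia <= x * x * ia)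
      by (apply Rmult_le_compat_r; lra).
    assert (q2 : (PI / beta * (PI / beta) - 2 * PI / (beta * beta) * eta) * ib <= y * y * ib)
      by (apply Rmult_le_compat_r; lra).
    unfold kappa, L, Rdiv in he2. unfold Rdiv in hxy, q1, q2.
    fold ia ib in hxy, he2. lra.
Qed.

Lemma semi_axes_bounds (chi : R) : 1 < chi -> 1 <= semi_axis_x chi /\ 0 < semi_axis_y chi.
Proof.
intros h. assert (hi : chi * / chi = 1) by (field; lra).
assert (hr : 0 < / chi < 1).
{ split; [apply Rinv_0_lt_compat; lra|].
  rewrite <- Rinv_1. apply Rinv_lt_contravar; lra. }
unfold semi_axis_x, semi_axis_y. split; [|lra].
generalize (Rle_0_sqr (chi - 1)); unfold Rsqr; intros.
assert (0 <= (chi - 1) * (chi - 1) * / chi) by (apply Rmult_le_pos; lra).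
replace ((chi - 1) * (chi - 1) * / chi) with (chi * chi * / chi - 2 * (chi * / chi) + / chi) in H0 by ring.
rewrite Rmult_assoc, hi in H0. lra.
Qed.

Lemma ellipse_solid (chi t : R) : 1 < chi ->
  solid_ellipse chi (semi_axis_x chi * cos t) (semi_axis_y chi * sin t).
Proof.
intros h; destruct (semi_axes_bounds chi h) as [ha hb]; unfold solid_ellipse.
right. rewrite <- (cos_sin_sq t). field. split; lra.
Qed.

Lemma segment_solid (chi x : R) : 1 < chi -> -1 <= x <= 1 -> solid_ellipse chi x 0.
Proof.
intros h hx; destruct (semi_axes_bounds chi h) as [ha hb]; unfold solid_ellipse.
set (a := semi_axis_x chi) in *.
replace (0 * 0 / (semi_axis_y chi * semi_axis_y chi)) with 0 by (field; lra).
rewrite Rplus_0_r. apply Rmult_le_reg_r with (a * a); [nra|].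
replace (x * x / (a * a) * (a * a)) with (x * x) by (field; lra). nra.
Qed.

Module PolynomialApproximation.

From mathcomp Require Import all_boot all_order all_algebra.
From mathcomp Require Import ring lra zify complex spectral Rstruct.
Set Implicit Arguments. Unset Strict Implicit. Unset Printing Implicit Defensive.
Import Order.TTheory GRing.Theory Num.Theory.
Import ComplexField.Normc.
Local Open Scope ring_scope.
Local Open Scope complex_scope.
Local Notation R := Rdefinitions.R.
Local Notation CC := (complex R).
Bind Scope ring_scope with Rdefinitions.RbaseSymbolsImpl.R.

(** * Complex modulus and exponential *)

Implicit Types (z w u : CC) (x y : R).

Lemma normc_ge0 z : 0 <= normc z.
Proof. by case: z => a b; exact: sqrtr_ge0. Qed.

Lemma normcD z w : normc (z + w) <= normc z + normc w.
Proof. exact: le_normcD. Qed.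

Lemma normc_opp z : normc (- z) = normc z.
Proof. exact: normcN. Qed.

Lemma normcB z w : normc (z - w) <= normc z + normc w.
Proof. by rewrite -(normc_opp w); exact: normcD. Qed.

Lemma normcBC z w : normc (z - w) = normc (w - z).
Proof. by rewrite -normc_opp opprB. Qed.

Lemma normcX z n : normc (z ^+ n) = normc z ^+ n.
Proof. by elim: n => [|n IH]; rewrite ?normc1 // !exprS normcM IH. Qed.

Lemma normc_real x : normc x%:C = `|x|.
Proof. by rewrite /= expr0n addr0 sqrtr_sqr. Qed.

Lemma normc_nat n : normc (n%:R : CC) = n%:R.
Proof. by rewrite -(rmorph_nat (real_complex R)) normc_real ger0_norm. Qed.

Lemma normc_sqr z : normc z ^+ 2 = complex.Re z ^+ 2 + complex.Im z ^+ 2.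
Proof. by case: z => a b /=; rewrite sqr_sqrtr // addr_ge0 ?sqr_ge0. Qed.

Lemma normc_sum (I : Type) (r : seq I) (P : pred I) (F : I -> CC) :
  normc (\sum_(i <- r | P i) F i) <= \sum_(i <- r | P i) normc (F i).
Proof.
elim/big_rec2: _ => [|i x z _ h]; first by rewrite normc0.
by apply: le_trans (normcD _ _) _; rewrite lerD2l.
Qed.

Lemma normc_le_sqr z (c : R) : 0 <= c -> normc z ^+ 2 <= c ^+ 2 -> normc z <= c.
Proof. by move=> hc; rewrite ler_pXn2r ?nnegrE ?normc_ge0. Qed.

Lemma Re_le_normc z : `|complex.Re z| <= normc z.
Proof.
rewrite -(@ler_pXn2r _ 2) ?nnegrE ?normc_ge0 // normc_sqr -normrX ger0_norm ?sqr_ge0 //.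
by rewrite lerDl sqr_ge0.
Qed.

Definition cexp z : CC :=
  Complex (exp (complex.Re z) * cos (complex.Im z)) (exp (complex.Re z) * sin (complex.Im z)).

Lemma cexpD z w : cexp (z + w) = cexp z * cexp w.
Proof.
case: z w => [a b] [c d]; rewrite /cexp /=; apply/eqP; rewrite eq_complex /=.
rewrite -expRD cosD sinD; apply/andP; split; apply/eqP; ring.
Qed.

Lemma cexp0 : cexp 0 = 1.
Proof. by rewrite /cexp /= exp_0 cos_0 sin_0 mulr1 mulr0. Qed.

Lemma cexpM_nat z n : cexp (z *+ n) = cexp z ^+ n.
Proof. by elim: n => [|n IH]; rewrite ?mulr0n ?cexp0 // mulrS exprS cexpD IH. Qed.

Lemma exp_gt0 x : 0 < exp x.
Proof. by apply/RltP; exact: exp_pos. Qed.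

Lemma exp_ge1D x : 1 + x <= exp x.
Proof. by apply/RleP; exact: exp_ineq1_le. Qed.

Lemma ler_exp x y : x <= y -> exp x <= exp y.
Proof.
rewrite le_eqVlt => /orP [/eqP -> //|/RltP h].
by apply/ltW/RltP; exact: exp_increasing.
Qed.

Lemma normc_cexp z : normc (cexp z) = exp (complex.Re z).
Proof.
rewrite /= !exprMn -mulrDr !expr2.
have -> : cos (complex.Im z) * cos (complex.Im z) + sin (complex.Im z) * sin (complex.Im z) = 1 :> R.
  exact: cos_sin_sq.
by rewrite mulr1 -expr2 sqrtr_sqr ger0_norm // ltW // exp_gt0.
Qed.

Lemma normc_cexp_le z : normc (cexp z) <= exp (normc z).
Proof. by rewrite normc_cexp ler_exp // (le_trans (ler_norm _)) // Re_le_normc. Qed.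

Lemma normc_cexp_second_order w :
  normc w <= 2^-1 -> normc (cexp w - 1 - w) <= 8 * normc w ^+ 2.
Proof.
move=> hw; apply: normc_le_sqr; first by rewrite mulr_ge0 ?sqr_ge0.
have : normc w ^+ 2 <= 4^-1 by have := normc_ge0 w; nra.
rewrite !normc_sqr; case: w hw => a b _ /= hab.
have h0 : Rle (Rplus (Rmult a a) (Rmult b b)) (Rinv (IZR 4)).
  by apply/RleP; rewrite !RealsE /= -!expr2.
have /RleP := cexp_second_order _ _ h0; rewrite !RealsE /= => h.
rewrite oppr0 addr0 !expr2; exact: h.
Qed.

(** * Uniform approximation by polynomials *)

Lemma norm_exprB_le (z w : CC) (m : R) n :
  normc z <= m -> normc w <= m -> normc (z ^+ n - w ^+ n) <= n%:R * normc (z - w) * m ^+ n.-1.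
Proof.
move=> hz hw; have hm : 0 <= m by apply: le_trans hz; exact: normc_ge0.
rewrite subrXX normcM [n%:R * _]mulrC -mulrA ler_wpM2l ?normc_ge0 //.
apply: le_trans (normc_sum _ _ _) _.
rewrite mulr_natl -[X in _ *+ X]card_ord -sumr_const ler_sum // => i _.
rewrite normcM !normcX.
have -> : n.-1 = (n.-1 - i + i)%N by rewrite subnK // -ltnS prednK ?(leq_trans _ (ltn_ord i)).
rewrite addnK exprD; apply: ler_pM; rewrite ?exprn_ge0 ?normc_ge0 //.
  by rewrite lerXn2r ?nnegrE ?normc_ge0.
by rewrite lerXn2r ?nnegrE ?normc_ge0.
Qed.

(** Both terms are N-th powers, of e^(u/N) and of 1 + u/N. These bases have modulus at most e^(r/N)
    and differ by at most 8 (r/N)^2, and passing to N-th powers costs a factor of at most N e^r.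
    This makes exp a uniform limit of polynomials without using its power series. *)
Lemma cexp_limit (u : CC) (r : R) (N : nat) :
  normc u <= r -> (0 < N)%N -> 2 * r <= N%:R ->
  normc (cexp u - (1 + u / N%:R) ^+ N) <= 8 * r ^+ 2 * exp r / N%:R.
Proof.
move=> hu hN hr.
have r0 : 0 <= r by apply: le_trans hu; exact: normc_ge0.
have N0 : 0 < N%:R :> R by rewrite ltr0n.
have NC : (N%:R : CC) != 0 by rewrite pnatr_eq0 -lt0n.
set w := u / N%:R.
have hw : normc w <= r / N%:R.
  by rewrite normcM normcV normc_nat ler_pM2r ?invr_gt0.
have -> : cexp u = cexp w ^+ N by rewrite -cexpM_nat -(mulr_natr w) divfK.
have hm : (exp (r / N%:R)) ^+ N = exp r by rewrite expRX -(mulr_natr (r / N%:R)) divfK // gt_eqF.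
have m1 : 1 <= exp (r / N%:R).
  by apply: le_trans (exp_ge1D _); rewrite lerDl divr_ge0 // ltW.
have b1 : normc (cexp w) <= exp (r / N%:R).
  by apply: le_trans (normc_cexp_le _) _; exact: ler_exp.
have b2 : normc (1 + w) <= exp (r / N%:R).
  apply: le_trans (normcD _ _) _; rewrite normc1.
  by apply: le_trans (exp_ge1D _); rewrite lerD2l.
apply: le_trans (norm_exprB_le N b1 b2) _.
have h2 : normc (cexp w - (1 + w)) <= 8 * (r / N%:R) ^+ 2.
  rewrite opprD addrA; apply: le_trans (normc_cexp_second_order _) _.
    by apply: le_trans hw _; rewrite ler_pdivrMr //; lra.
  by rewrite ler_wpM2l // lerXn2r ?nnegrE ?normc_ge0 // divr_ge0 // ltW.
have h3 : exp (r / N%:R) ^+ N.-1 <= exp r by rewrite -hm ler_weXn2l // leq_pred.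
apply: (@le_trans _ _ (N%:R * (8 * (r / N%:R) ^+ 2) * exp r)).
  apply: ler_pM => //; last by rewrite ler_pM2l.
    by rewrite mulr_ge0 ?normc_ge0 // ltW.
  by rewrite exprn_ge0 // ltW // exp_gt0.
by rewrite le_eqVlt; apply/orP; left; apply/eqP; field; rewrite gt_eqF.
Qed.

Lemma archi_nat (x : R) : exists2 N : nat, (0 < N)%N & x <= N%:R.
Proof.
exists (Num.bound `|x|).+1 => //.
apply: le_trans (ler_norm _) _; apply: ltW; apply: lt_trans (archi_boundP (normr_ge0 x)) _.
by rewrite ltr_nat.
Qed.

Lemma archi_small (x e : R) : 0 < e -> exists2 N : nat, (0 < N)%N & x / N%:R <= e.
Proof.
move=> he; have [N N0 hN] := archi_nat (x / e).
exists N => //; rewrite ler_pdivrMr ?ltr0n //.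
by move: hN; rewrite ler_pdivrMr // mulrC.
Qed.

(** [K] is an arbitrary set without topology; the boundedness that compactness would give is carried
    along as [bounded_on], which products require. *)
Definition papprox (K : CC -> Prop) (f : CC -> CC) : Prop :=
  forall e : R, 0 < e -> exists p : {poly CC}, forall z, K z -> normc (f z - p.[z]) <= e.

Definition bounded_on (K : CC -> Prop) (f : CC -> CC) (B : R) : Prop :=
  forall z, K z -> normc (f z) <= B.

Section Approximation.
Variable K : CC -> Prop.
Implicit Types f g h : CC -> CC.

Lemma papprox_ext f g : (forall z, K z -> f z = g z) -> papprox K f -> papprox K g.
Proof.
move=> hfg hf e he; have [p hp] := hf e he.
by exists p => z hz; rewrite -hfg //; exact: hp.
Qed.

Lemma papprox_poly (p : {poly CC}) : papprox K (fun z => p.[z]).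
Proof. by move=> e he; exists p => z _; rewrite subrr normc0 ltW. Qed.

Lemma papprox_lim f :
  (forall e : R, 0 < e -> exists2 g, papprox K g & bounded_on K (fun z => f z - g z) e) ->
  papprox K f.
Proof.
move=> hf e he; have e2 : 0 < e / 2 by lra.
have [g hg hfg] := hf _ e2; have [p hp] := hg _ e2.
exists p => z hz; rewrite -(subrKA (g z)); apply: le_trans (normcD _ _) _.
by have := hfg z hz; have := hp z hz; lra.
Qed.

Lemma papproxD f g : papprox K f -> papprox K g -> papprox K (fun z => f z + g z).
Proof.
move=> hf hg e he; have e2 : 0 < e / 2 by lra.
have [p hp] := hf _ e2; have [q hq] := hg _ e2.
exists (p + q) => z hz; rewrite hornerD opprD addrACA; apply: le_trans (normcD _ _) _.
by have := hp z hz; have := hq z hz; lra.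
Qed.

Lemma papproxM f g (Bf Bg : R) : bounded_on K f Bf -> bounded_on K g Bg ->
  papprox K f -> papprox K g -> papprox K (fun z => f z * g z).
Proof.
move=> bf bg hf hg e he.
pose Cf := `|Bf| + 1; pose Cg := `|Bg| + 1.
have Cf0 : 0 < Cf by rewrite ltr_wpDl.
have Cg0 : 0 < Cg by rewrite ltr_wpDl.
have eq0 : 0 < e / 2 / Cf by rewrite !divr_gt0.
have ep0 : 0 < e / 2 / Cg by rewrite !divr_gt0.
(* The 1 keeps |q| below [Cg]; the other thresholds give each of the two error terms half of e. *)
have em0 : 0 < Num.min 1 (e / 2 / Cf) by rewrite lt_min ltr01 eq0.
have [q hq] := hg _ em0; have [p hp] := hf _ ep0.
exists (p * q) => z hz; rewrite hornerM.
have := hq z hz; rewrite le_min => /andP [hq1 hq2]; have hpz := hp z hz.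
have -> : f z * g z - p.[z] * q.[z] = f z * (g z - q.[z]) + (f z - p.[z]) * q.[z] by ring.
apply: le_trans (normcD _ _) _; rewrite !normcM.
have bq : normc q.[z] <= Cg.
  have -> : q.[z] = g z - (g z - q.[z]) by ring.
  apply: le_trans (normcB _ _) _; apply: lerD => //.
  by apply: le_trans (bg z hz) (ler_norm _).
have bfz : normc (f z) <= Cf.
  by apply: le_trans (bf z hz) _; apply: le_trans (ler_norm _) _; rewrite lerDl.
have -> : e = Cf * (e / 2 / Cf) + (e / 2 / Cg) * Cg by field; rewrite !gt_eqF.
by apply: lerD; apply: ler_pM => //; exact: normc_ge0.
Qed.

Lemma papproxX f (B : R) n : bounded_on K f B -> papprox K f -> papprox K (fun z => f z ^+ n).
Proof.
move=> bf hf; elim: n => [|n IH].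
  by apply: papprox_ext (papprox_poly 1) => z _; rewrite hornerC expr0.
apply: papprox_ext (fun z _ => esym (exprS (f z) n)) _.
apply: (papproxM bf _ hf IH) => z hz; rewrite normcX.
by apply: (lerXn2r n _ _ (bf z hz)); rewrite nnegrE ?normc_ge0 ?(le_trans (normc_ge0 _) (bf z hz)).
Qed.

Lemma papprox_sum (F : nat -> CC -> CC) n :
  (forall k, papprox K (F k)) -> papprox K (fun z => \sum_(k < n) F k z).
Proof.
move=> hF; elim: n => [|n IH].
  by apply: papprox_ext (papprox_poly 0) => z _; rewrite hornerC big_ord0.
by apply: papprox_ext (papproxD IH (hF n)) => z _; rewrite big_ord_recr.
Qed.

Lemma geom_tail (w : CC) n : normc w <= 2^-1 ->
  normc ((1 - w)^-1 - \sum_(k < n) w ^+ k) <= 2 * 2^-1 ^+ n.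
Proof.
move=> hw.
have h1 : 2^-1 <= normc (1 - w).
  have := normcB (1 - w) (- w); rewrite opprK subrK normc1 normc_opp; lra.
have w1 : 1 - w != 0.
  by apply/eqP => h0; move: h1; rewrite h0 normc0; lra.
have -> : (1 - w)^-1 - \sum_(k < n) w ^+ k = w ^+ n / (1 - w).
  apply: (mulfI w1); rewrite mulrBr mulfV // [RHS]mulrC divfK //.
  by rewrite -(opprB w 1) mulNr -subrX1; ring.
have i1 : (normc (1 - w))^-1 <= 2 by rewrite invf_ple ?posrE //; lra.
rewrite normcM normcX normcV mulrC; apply: ler_pM => //.
- by rewrite invr_ge0 normc_ge0.
- by rewrite exprn_ge0 // normc_ge0.
by rewrite lerXn2r ?nnegrE ?normc_ge0 //; lra.
Qed.

Lemma papprox_neumann h :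
  bounded_on K h 2^-1 -> papprox K h -> papprox K (fun z => (1 - h z)^-1).
Proof.
move=> bh hh; apply: papprox_lim => e he.
have [N N0 hN] := archi_small 2 he.
exists (fun z => \sum_(k < N) h z ^+ k).
  by apply: (papprox_sum (F := fun k z => h z ^+ k)) => k; exact: papproxX bh hh.
move=> z hz; apply: le_trans (geom_tail N (bh z hz)) _; apply: le_trans hN.
(* 2^-N is traded for the weaker 1/N, which [archi_small] controls. *)
rewrite ler_pM2l // exprVn lef_pV2 ?posrE ?exprn_gt0 ?ltr0n //.
by rewrite -natrX ler_nat ltnW // ltn_expl.
Qed.

(* Openness of invertibility in the closure of the polynomials:
   [g'^-1 = g^-1 (1 - (g - g') g^-1)^-1]. *)
Lemma papprox_inv_near f g (B d : R) : 0 < d -> bounded_on K f B -> bounded_on K g B ->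
  (forall z, K z -> d <= normc (f z)) -> (forall z, K z -> d <= normc (g z)) ->
  bounded_on K (fun z => f z - g z) (d / 2) ->
  papprox K f -> papprox K g -> papprox K (fun z => (f z)^-1) -> papprox K (fun z => (g z)^-1).
Proof.
move=> d0 bf bg df dg bfg hf hg hfi.
have bfi : bounded_on K (fun z => (f z)^-1) d^-1.
  by move=> z hz; rewrite normcV lef_pV2 ?posrE ?df // (lt_le_trans d0) ?df.
have nz h : (forall z, K z -> d <= normc (h z)) -> forall z, K z -> h z != 0.
  move=> dh z hz; apply/eqP => h0; have := dh z hz; rewrite h0 normc0; lra.
have hgN : papprox K (fun z => f z - g z).
  apply: papprox_ext (papproxD hf (papproxM (f := fun=> -1) (Bf := 1) _ bg _ hg)).
  - by move=> z _; rewrite mulN1r.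
  - by move=> z _; rewrite normc_opp normc1.
  - by apply: papprox_ext (papprox_poly (-1)%:P) => z _; rewrite hornerC.
pose h z := (f z - g z) * (f z)^-1.
have hh : papprox K h by exact: papproxM bfg bfi hgN hfi.
have bh : bounded_on K h 2^-1.
  move=> z hz; rewrite normcM.
  have -> : 2^-1 = d / 2 * d^-1 :> R by field; rewrite gt_eqF.
  by apply: ler_pM; rewrite ?normc_ge0 ?bfg ?bfi.
have bn : bounded_on K (fun z => (1 - h z)^-1) 2%:R.
  move=> z hz; rewrite normcV.
  have h1 : 2^-1 <= normc (1 - h z).
    have := normcB (1 - h z) (- h z); rewrite opprK subrK normc1 normc_opp.
    have := bh z hz; lra.
  by rewrite invf_ple ?posrE //; lra.
apply: papprox_ext (papproxM bfi bn hfi (papprox_neumann bh hh)) => z hz.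
have fz := nz f df z hz; have gz := nz g dg z hz.
have -> : 1 - h z = g z / f z by rewrite /h; field.
by field; rewrite fz gz.
Qed.

Lemma papprox_cexp f (B : R) :
  bounded_on K f B -> papprox K f -> papprox K (fun z => cexp (f z)).
Proof.
move=> bf hf; apply: papprox_lim => e he.
pose r := `|B|.
have [N1 N10 hN1] := archi_small (8 * r ^+ 2 * exp r) he.
have [N2 N20 hN2] := archi_nat (2 * r).
(* A common multiple meets both demands: N1 gives the accuracy, N2 gives r / N <= 1/2. *)
pose N := (N1 * N2)%N.
have N0 : (0 < N)%N by rewrite muln_gt0 N10 N20.
exists (fun z => (1 + f z / N%:R) ^+ N).
  apply: (@papproxX _ (1 + r / N%:R)).
    move=> z hz; apply: le_trans (normcD _ _) _; rewrite normc1 lerD2l normcM normcV normc_nat.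
    by rewrite ler_pM2r ?invr_gt0 ?ltr0n // (le_trans (bf z hz)) // ler_norm.
  apply: papproxD; first by apply: papprox_ext (papprox_poly 1) => z _; rewrite hornerC.
  apply: (papproxM bf (Bg := N%:R^-1) _ hf) => [z _|]; first by rewrite normcV normc_nat.
  by apply: papprox_ext (papprox_poly (N%:R^-1)%:P) => z _; rewrite hornerC.
move=> z hz; apply: le_trans (@cexp_limit _ r N _ N0 _) _.
- by apply: le_trans (bf z hz) _; exact: ler_norm.
- by apply: le_trans hN2 _; rewrite ler_nat /N leq_pmull.
apply: le_trans hN1; rewrite ler_wpM2l ?mulr_ge0 ?normr_ge0 ?(ltW (exp_gt0 _)) //.
by rewrite lef_pV2 ?posrE ?ltr0n // ler_nat /N leq_pmulr.
Qed.

(* The poles of [1 / (1 + exp (s f))] come from infinity as [s] grows from 0 to 1; as long as they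
   stay at a uniform distance from [K], finitely many Neumann series connect [s = 0] to [s = 1]. *)
Lemma papprox_fermi f (B d : R) : 0 < d -> bounded_on K f B -> papprox K f ->
  (forall (s : R) z, 0 <= s <= 1 -> K z -> d <= normc (1 + cexp (s%:C * f z))) ->
  papprox K (fun z => (1 + cexp (f z))^-1).
Proof.
move=> d0 bf hf hd.
pose r := `|B|.
have bfr : bounded_on K f r by move=> z hz; apply: le_trans (bf z hz) (ler_norm _).
have r0 : 0 <= r by exact: normr_ge0.
have hscal (s : R) : 0 <= s <= 1 ->
    bounded_on K (fun z => s%:C * f z) r /\ papprox K (fun z => s%:C * f z).
  move=> /andP [s0 s1]; split.
    move=> z hz; rewrite normcM normc_real ger0_norm // -[leRHS]mul1r.
    by apply: ler_pM; rewrite ?normc_ge0 ?bfr.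
  apply: (papproxM (Bf := `|s|) _ bf _ hf).
    by move=> z _; rewrite normc_real.
  by apply: papprox_ext (papprox_poly s%:C%:P) => z _; rewrite hornerC.
have hg (s : R) : 0 <= s <= 1 -> bounded_on K (fun z => 1 + cexp (s%:C * f z)) (1 + exp r)
    /\ papprox K (fun z => 1 + cexp (s%:C * f z)).
  move=> hs; have [bs ps] := hscal s hs; split.
    move=> z hz; apply: le_trans (normcD _ _) _; rewrite normc1 lerD2l.
    by apply: le_trans (normc_cexp_le _) _; apply: ler_exp; exact: bs.
  apply: papproxD; last exact: papprox_cexp bs ps.
  by apply: papprox_ext (papprox_poly 1) => z _; rewrite hornerC.
have d2 : 0 < d / 2 by lra.
(* Moving s by 1/N changes 1 + exp (s f) by exp (s f) (exp v - 1) with v = f / N, of modulus at most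
   e^r (r + 8 r^2) / N; [papprox_inv_near] allows a change of d / 2. *)
have [N1 N10 hN1] := archi_small (exp r * (r + 8 * r ^+ 2)) d2.
have [N2 N20 hN2] := archi_nat (2 * r).
pose N := (N1 * N2)%N.
have N0 : (0 < N)%N by rewrite muln_gt0 N10 N20.
have N0R : 0 < N%:R :> R by rewrite ltr0n.
have N1R : 1 <= N%:R :> R by rewrite ler1n.
have hN1' : exp r * (r + 8 * r ^+ 2) / N%:R <= d / 2.
  apply: le_trans hN1; rewrite ler_wpM2l ?mulr_ge0 ?(ltW (exp_gt0 _)) ?addr_ge0 ?mulr_ge0 //.
  by rewrite lef_pV2 ?posrE ?ltr0n // ler_nat /N leq_pmulr.
have hN2' : 2 * r <= N%:R by apply: le_trans hN2 _; rewrite ler_nat /N leq_pmull.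
pose s k : R := k%:R / N%:R.
have hs k : (k <= N)%N -> 0 <= s k <= 1.
  by move=> hk; rewrite divr_ge0 ?ler0n //= ler_pdivrMr // mul1r ler_nat.
suff main k : (k <= N)%N -> papprox K (fun z => (1 + cexp ((s k)%:C * f z))^-1).
  apply: papprox_ext (main N (leqnn N)) => z _.
  by rewrite /s divff ?gt_eqF // mul1r.
elim: k => [_|k IH hk].
  apply: papprox_ext (papprox_poly (2^-1)%:P) => z _.
  by rewrite hornerC /s !mul0r cexp0.
have [b0 p0] := hg _ (hs k (ltnW hk)); have [b1 p1] := hg _ (hs k.+1 hk).
apply: (papprox_inv_near d0 b0 b1 _ _ _ p0 p1 (IH (ltnW hk))).
- by move=> z hz; apply: hd => //; exact: hs (ltnW hk).
- by move=> z hz; apply: hd => //; exact: hs.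
move=> z hz; rewrite opprD addrACA subrr add0r.
pose v : CC := (N%:R^-1)%:C * f z.
have -> : (s k.+1)%:C * f z = (s k)%:C * f z + v.
  by rewrite -mulrDl -rmorphD /= /s -addn1 natrD mulrDl mul1r.
have hv : normc v <= r / N%:R.
  rewrite normcM normc_real ger0_norm ?invr_ge0 ?(ltW N0R) // mulrC.
  by rewrite ler_pM2r ?invr_gt0 // bfr.
rewrite cexpD -{1}[cexp (_ * f z)]mulr1 -mulrBr normcM normcBC.
apply: le_trans hN1'; rewrite -mulrA; apply: ler_pM; rewrite ?normc_ge0 //.
  apply: le_trans (normc_cexp_le _) _; apply: ler_exp.
  by have [+ _] := hscal _ (hs k (ltnW hk)); apply.
have -> : cexp v - 1 = v + (cexp v - 1 - v) by ring.
apply: le_trans (normcD _ _) _; rewrite mulrDl; apply: lerD => //.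
have hrN : r / N%:R <= 2^-1 by rewrite ler_pdivrMr //; lra.
apply: le_trans (normc_cexp_second_order (le_trans hv hrN)) _.
rewrite -mulrA ler_wpM2l //.
apply: (@le_trans _ _ ((r / N%:R) ^+ 2)).
  by rewrite lerXn2r ?nnegrE ?normc_ge0 ?divr_ge0 // ltW.
rewrite expr_div_n ler_wpM2l ?sqr_ge0 // lef_pV2 ?posrE ?exprn_gt0 //.
by rewrite expr2; nra.
Qed.

End Approximation.

(** * Chebyshev expansions and Bernstein's inequality *)

Fixpoint cheb (n : nat) : {poly CC} :=
  match n with
  | 0 => 1
  | n1.+1 => match n1 with 0 => 'X | n2.+1 => 'X * cheb n1 *+ 2 - cheb n2 end
  end.

Lemma chebSS n : cheb n.+2 = 'X * cheb n.+1 *+ 2 - cheb n.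
Proof. by []. Qed.

(** The product (w + 1/w) (w^(n+1) + w^-(n+1)) is the sum of the terms of index n + 2 and n, which
    is the Chebyshev recurrence. The map w -> (w + 1/w) / 2 sends |w| = chi to the ellipse and |w| =
    1 to the segment, so the identity serves both the coefficient bound and |T_n| <= 1. *)
Lemma cheb_joukowski w n : w != 0 -> (cheb n).[(w + w^-1) / 2] = (w ^+ n + w^-1 ^+ n) / 2.
Proof.
move=> w0.
suff [] : (cheb n).[(w + w^-1) / 2] = (w ^+ n + w^-1 ^+ n) / 2
    /\ (cheb n.+1).[(w + w^-1) / 2] = (w ^+ n.+1 + w^-1 ^+ n.+1) / 2 by [].
elim: n => [|n [IH1 IH2]].
  by rewrite /= hornerX !expr0 !expr1 hornerC; split=> //; field.
split=> //; rewrite chebSS hornerD hornerN hornerMn hornerM hornerX IH1 IH2 !exprS.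
by field.
Qed.

Lemma size_cheb n : (size (cheb n) <= n.+1)%N.
Proof.
suff [] : (size (cheb n) <= n.+1)%N /\ (size (cheb n.+1) <= n.+2)%N by [].
elim: n => [|n [IH1 IH2]]; first by rewrite /= size_poly1 size_polyX.
split=> //; rewrite chebSS (leq_trans (size_polyD _ _)) // geq_max size_polyN.
rewrite (leq_trans IH1) ?andbT; last by rewrite leqW.
rewrite mulr2n (leq_trans (size_polyD _ _)) // maxnn.
by rewrite (leq_trans (size_polyMleq _ _)) // size_polyX.
Qed.

Lemma cheb_lead_neq0 n : (cheb n)`_n != 0.
Proof.
suff [] : (cheb n)`_n != 0 /\ (cheb n.+1)`_n.+1 != 0 by [].
elim: n => [|n [IH1 IH2]]; first by rewrite /= coef1 coefX oner_eq0.
split=> //; rewrite chebSS coefD coefN coefMn coefXM /=.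
rewrite (nth_default _ (leqW (size_cheb n))) subr0.
by rewrite mulrn_eq0.
Qed.

(** Each step cancels the top coefficient by a multiple of [cheb n], whose leading coefficient is
    nonzero. *)
Lemma cheb_expansion n (p : {poly CC}) : (size p <= n)%N ->
  exists a : nat -> CC, p = \sum_(k < n) a k *: cheb k.
Proof.
elim: n p => [|n IH] p hp.
  exists (fun=> 0); rewrite big_ord0.
  by apply/eqP; rewrite -size_poly_leq0.
pose c := p`_n / (cheb n)`_n.
have [|a ha] := IH (p - c *: cheb n).
  apply/leq_sizeP => j; rewrite leq_eqVlt => /orP [/eqP <-|hj].
    by rewrite coefB coefZ /c divfK ?subrr // cheb_lead_neq0.
  rewrite coefB coefZ !nth_default ?mulr0 ?subr0 //.
    exact: leq_trans (size_cheb n) hj.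
  exact: leq_trans hp hj.
exists (fun k => if k == n then c else a k).
rewrite big_ord_recr /= eqxx -[LHS](subrK (c *: cheb n)) ha; congr (_ + _).
by apply: eq_bigr => i _; rewrite ltn_eqF.
Qed.

(** * Roots of unity and equidistributed points of the ellipse *)

Definition cis (t : R) : CC := cexp (Complex 0 t).

Lemma cisE t : cis t = Complex (cos t) (sin t).
Proof. by rewrite /cis /cexp /= exp_0 !mul1r. Qed.

Lemma normc_cis t : normc (cis t) = 1.
Proof. by rewrite normc_cexp /= exp_0. Qed.

Lemma cis_neq0 t : cis t != 0.
Proof. by apply/eqP => h; have := normc_cis t; rewrite h normc0 => /esym/eqP; rewrite oner_eq0. Qed.

Lemma cisX t n : cis t ^+ n = cis (t *+ n).
Proof.
rewrite /cis -cexpM_nat; congr cexp.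
by elim: n => [|n IH]; rewrite ?mulr0n // !mulrS IH; apply/eqP; rewrite eq_complex /= add0r !eqxx.
Qed.

Lemma cisV t : (cis t)^-1 = Complex (cos t) (- sin t).
Proof.
apply: (mulfI (cis_neq0 t)); rewrite divff ?cis_neq0 // cisE.
apply/eqP; rewrite eq_complex /=; apply/andP; split; apply/eqP; last by ring.
by rewrite mulrN opprK; exact/esym/cos_sin_sq.
Qed.

Lemma cos_lt1 (t : R) : 0 < t -> t < 2 * PI -> cos t <> 1.
Proof.
move=> t0 t1 h.
have hs : 0 < sin (t / 2).
  by apply/RltP; apply: sin_gt_0; apply/RltP; rewrite ?R0E; lra.
have := cos_2a_sin (t / 2).
have -> : Rmult (IZR 2) (t / 2) = t by rewrite !RealsE /=; field.
by rewrite h !RealsE /= => e; have := mulr_gt0 hs hs; lra.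
Qed.

Lemma prim_root_cis N : (0 < N)%N -> N.-primitive_root (cis (2 * PI / N%:R)).
Proof.
move=> N0; have N0R : 0 < N%:R :> R by rewrite ltr0n.
have PI0 : 0 < PI :> R by apply/RltP; exact: PI_RGT_0.
apply/andP; split=> //; apply/forallP => i; apply/eqP.
rewrite unity_rootE cisX cisE; have [->|hi] := eqVneq i.+1 N.
  rewrite -(mulr_natr (_ / _)) divfK ?lt0r_neq0 //.
  have -> : 2 * PI = Rmult (IZR 2) PI :> R by rewrite !RealsE.
  by rewrite cos_2PI sin_2PI eqxx.
have iN : (i.+1 < N)%N by rewrite ltn_neqAle hi ltn_ord.
have iR : 0 < i.+1%:R :> R by rewrite ltr0n.
apply/negbTE/negP; rewrite eq_complex /= => /andP [/eqP h _]; move: h; apply: cos_lt1.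
  by rewrite -(mulr_natr (_ / _)) mulr_gt0 // divr_gt0 // mulr_gt0.
rewrite -(mulr_natr (_ / _)) mulrAC ltr_pdivrMr // ltr_pM2l ?ltr_nat //.
by rewrite mulr_gt0.
Qed.

(** A geometric sum whose ratio zeta^l has N-th power 1: it vanishes unless the ratio is itself
    1. *)
Lemma sum_prim_root (N l : nat) (zeta : CC) : N.-primitive_root zeta ->
  \sum_(j < N) (zeta ^+ j) ^+ l = if (N %| l)%N then N%:R else 0.
Proof.
move=> hz; rewrite (eq_bigr (fun j : 'I_N => (zeta ^+ l) ^+ j)); last first.
  by move=> j _; rewrite -!exprM mulnC.
case: ifP => hl.
  have /eqP -> : zeta ^+ l == 1 by rewrite -(prim_order_dvd hz).
  by rewrite (eq_bigr (fun=> 1)) => [|j _]; rewrite ?expr1n // sumr_const card_ord.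
have h1 : zeta ^+ l - 1 != 0 by rewrite subr_eq0 -(prim_order_dvd hz) hl.
apply: (mulfI h1); rewrite -subrX1 mulr0 -exprM mulnC exprM (prim_expr_order hz).
by rewrite expr1n subrr.
Qed.

Definition ellipse_pt (chi t : R) : CC :=
  Complex ((chi + chi^-1) / 2 * cos t) ((chi - chi^-1) / 2 * sin t).

Lemma ellipse_ptE (chi t : R) : 0 < chi ->
  let w := chi%:C * cis t in ellipse_pt chi t = (w + w^-1) / 2.
Proof.
move=> hc; rewrite /= invfM cisV cisE -fmorphV /=.
have -> : 2^-1 = (2^-1)%:C :> CC by rewrite fmorphV rmorph_nat.
by apply/eqP; rewrite eq_complex /=; apply/andP; split; apply/eqP; field; rewrite gt_eqF.
Qed.

Lemma prim_root_dvdn_small N d : (0 < d < 2 * N)%N -> (N %| d)%N = (d == N).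
Proof.
move=> /andP [d0 d2]; apply/idP/eqP => [/dvdnP [q dq]|-> //].
by case: q dq => [|[|q]] dq; nia.
Qed.

(* Averaging [p(z) w^-m] over the points [z = (w + 1/w) / 2], [w = chi zeta^j], of the ellipse
   isolates the m-th coefficient. *)
Lemma cheb_coef_bound n (a : nat -> CC) (chi M : R) : 0 < chi ->
  (forall t, normc (\sum_(k < n) a k *: cheb k).[ellipse_pt chi t] <= M) ->
  forall m, (0 < m < n)%N -> normc (a m) <= 2 * M * chi^-1 ^+ m.
Proof.
move=> hc hM m /andP [m0 mn].
(* For k, m < n the exponents N - m + k and N - m - k lie strictly between 0 and 2N, so they are
   divisible by N only when equal to N. The first equals N just for k = m, the second never because
   m > 0. The phase of w^-m is written zeta^(j (N - m)) to keep exponents natural. *)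
pose N := (2 * n)%N; have N0 : (0 < N)%N by rewrite /N muln_gt0 (leq_ltn_trans _ mn).
have hz := prim_root_cis N0; set zeta := cis _ in hz.
have chi0 : chi%:C != 0 :> CC by rewrite eq_complex /= eqxx andbT gt_eqF.
have zeta0 : zeta != 0 by exact: cis_neq0.
pose z j := ellipse_pt chi (2 * PI / N%:R *+ j).
have term (k j : nat) : (k <= N - m)%N -> (a k *: cheb k).[z j] * (zeta ^+ j) ^+ (N - m)
    = a k * chi%:C ^+ k / 2 * (zeta ^+ j) ^+ (N - m + k)
      + a k * chi%:C^-1 ^+ k / 2 * (zeta ^+ j) ^+ (N - m - k).
  move=> hk; rewrite /z ellipse_ptE // -cisX -/zeta hornerZ cheb_joukowski; last first.
    by rewrite mulf_neq0 ?expf_neq0.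
  have zj0 : zeta ^+ j != 0 by exact: expf_neq0.
  rewrite -{1 2}(subnK hk) !exprD invfM !exprMn !exprVn.
  by field; rewrite !expf_neq0.
have key : \sum_(j < N) (\sum_(k < n) a k *: cheb k).[z j] * (zeta ^+ j) ^+ (N - m)
    = N%:R * (a m * chi%:C ^+ m / 2).
  have e1 (j : 'I_N) : true -> (\sum_(k < n) a k *: cheb k).[z j] * (zeta ^+ j) ^+ (N - m)
    = \sum_(k < n) (a k * chi%:C ^+ k / 2 * (zeta ^+ j) ^+ (N - m + k)
                    + a k * chi%:C^-1 ^+ k / 2 * (zeta ^+ j) ^+ (N - m - k)).
    move=> _; rewrite horner_sum big_distrl /=; apply: eq_bigr => k _; apply: term.
    by have := ltn_ord k; rewrite /N; lia.
  rewrite (eq_bigr _ e1) exchange_big /= (bigD1 (Ordinal mn)) //= [X in _ + X]big1 ?addr0 => [|k hk].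
    rewrite big_split /= -!mulr_sumr !(sum_prim_root _ hz) !prim_root_dvdn_small.
    - have -> : (N - m + m == N)%N by rewrite subnK // /N; lia.
      have -> : (N - m - m == N)%N = false by rewrite /N; lia.
      by rewrite mulr0 addr0 mulrC.
    - by rewrite /N; lia.
    - by rewrite /N; lia.
  have kn := ltn_ord k; have km : (k != m :> nat) by [].
  rewrite big_split /= -!mulr_sumr !(sum_prim_root _ hz) !prim_root_dvdn_small.
  - have -> : (N - m + k == N)%N = false by rewrite /N; lia.
    have -> : (N - m - k == N)%N = false by rewrite /N; lia.
    by rewrite !mulr0 addr0.
  - by rewrite /N; lia.
  - by rewrite /N; lia.
have N0R : 0 < N%:R :> R by rewrite ltr0n.
have := normc_sum (index_enum 'I_N) xpredT
  (fun j : 'I_N => (\sum_(k < n) a k *: cheb k).[z j] * (zeta ^+ j) ^+ (N - m)).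
rewrite key => hle.
have {}hle : normc (N%:R * (a m * chi%:C ^+ m / 2)) <= N%:R * M.
  apply: le_trans hle _; rewrite mulr_natl -[X in _ *+ X]card_ord -sumr_const.
  apply: ler_sum => j _; rewrite normcM !normcX normc_cis !expr1n mulr1; exact: hM.
move: hle; rewrite !normcM normcX normcV !normc_nat ler_pM2l // normc_real gtr0_norm // => hle.
rewrite exprVn ler_pdivlMr ?exprn_gt0 //; lra.
Qed.

Lemma cheb_le1 (x : R) k : -1 <= x <= 1 -> normc (cheb k).[x%:C] <= 1.
Proof.
move=> /andP [x0 x1].
have hx : cos (acos x) = x by apply: cos_acos; split; apply/RleP; rewrite ?RealsE.
have -> : x%:C = (cis (acos x) + (cis (acos x))^-1) / 2.
  have -> : 2^-1 = (2^-1)%:C :> CC by rewrite fmorphV rmorph_nat.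
  rewrite cisV cisE hx.
  by apply/eqP; rewrite eq_complex /=; apply/andP; split; apply/eqP; field.
rewrite cheb_joukowski ?cis_neq0 // normcM normcV normc_nat ler_pdivrMr // mul1r.
apply: le_trans (normcD _ _) _; rewrite !normcX normcV normc_cis invr1 !expr1n; lra.
Qed.

Lemma geom_sum_le (r : R) d n : 0 < r < 1 -> \sum_(d <= k < n) r ^+ k <= r ^+ d / (1 - r).
Proof.
move=> /andP [r0 r1]; have r10 : 0 < 1 - r by lra.
have [hdn|hdn] := leqP d n; last first.
  by rewrite big_geq ?divr_ge0 ?exprn_ge0 ?ltW // ltnW.
rewrite ler_pdivlMr // mulr_suml (eq_bigr (fun k => (- r ^+ k.+1) - (- r ^+ k))).
  by rewrite telescope_sumr // opprK; have := exprn_ge0 n (ltW r0); lra.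
by move=> k _; rewrite exprS; ring.
Qed.

Lemma bernstein (p : {poly CC}) (chi M : R) d : 1 < chi ->
  (forall t, normc p.[ellipse_pt chi t] <= M) -> (0 < d)%N ->
  exists2 q : {poly CC}, (size q <= d)%N &
    forall x : R, -1 <= x <= 1 ->
      normc (p.[x%:C] - q.[x%:C]) <= 2 * chi * M / (chi - 1) * chi^-1 ^+ d.
Proof.
move=> hchi hM d0.
have M0 : 0 <= M by apply: le_trans (hM 0); exact: normc_ge0.
have chi0 : 0 < chi by lra.
pose n := maxn (size p) d.
have [a ha] := cheb_expansion (leq_maxl (size p) d).
have dn : (d <= n)%N by exact: leq_maxr.
rewrite -/n in ha.
have hcoef := cheb_coef_bound chi0 _ (n := n) (a := a) (M := M).
(* Only degrees below d are kept, so the discarded tail starts at k = d; since d > 0, it avoids the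
   coefficient of index 0, which [cheb_coef_bound] does not cover. *)
exists (\sum_(0 <= k < d) a k *: cheb k).
  rewrite big_nat; elim/big_rec: _ => [|k q /andP [_ kd] hq]; first by rewrite size_poly0.
  rewrite (leq_trans (size_polyD _ _)) // geq_max hq andbT.
  by rewrite (leq_trans (size_scale_leq _ _)) // (leq_trans (size_cheb _)).
move=> x hx.
rewrite {1}ha -(big_mkord xpredT (fun k => a k *: cheb k)) (big_cat_nat (n := d)) //=.
rewrite hornerD addrAC subrr add0r horner_sum.
apply: le_trans (normc_sum _ _ _) _.
apply: (@le_trans _ _ (\sum_(d <= k < n) 2 * M * chi^-1 ^+ k)).
  rewrite !big_nat; apply: ler_sum => k /andP [dk kn].
  rewrite hornerZ normcM -[leRHS]mulr1; apply: ler_pM; rewrite ?normc_ge0 ?cheb_le1 //.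
  apply: hcoef => [t|]; first by rewrite -ha.
  by rewrite kn (leq_trans d0).
rewrite -mulr_sumr.
have -> : 2 * chi * M / (chi - 1) * chi^-1 ^+ d = 2 * M * (chi^-1 ^+ d / (1 - chi^-1)).
  by field; rewrite !gt_eqF // subr_gt0.
apply: ler_wpM2l; first by rewrite mulr_ge0.
by apply: geom_sum_le; rewrite invr_gt0 chi0 invf_lt1.
Qed.

(** * Spectral calculus of normal matrices *)

Lemma normc_conj z : normc (Num.conj z) = normc z.
Proof. by case: z => a b /=; rewrite sqrrN. Qed.

Lemma mul_conj_normc z : z * Num.conj z = (normc z ^+ 2)%:C.
Proof. by rewrite normc_sqr; case: z => a b; apply/eqP; rewrite eq_complex /=; apply/andP; split; apply/eqP; ring. Qed.

Lemma col_mulmx (m n p : nat) (A : 'M[CC]_(m, n)) (B : 'M_(n, p)) j :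
  col j (A *m B) = A *m col j B.
Proof. by rewrite !colE mulmxA. Qed.

(** A unitary eigenbasis of A also diagonalizes G, with eigenvalues bounded by e. The hypothesis
    speaks of eigenvectors one at a time, so that G may involve the Fermi matrix, known only through
    a limit and an inverse. *)
Lemma normal_entry_bound n (A G : 'M[CC]_n) (e : R) : A \is normalmx ->
  (forall (lam : CC) (v : 'cV[CC]_n), v != 0 -> A *m v = lam *: v ->
    exists2 g : CC, G *m v = g *: v & normc g <= e) ->
  forall i j, normc (G i j) <= e.
Proof.
move=> /orthomx_spectralP hA hG i j.
set P := spectralmx A in hA; set D := spectral_diag A in hA.
have hP : P \is unitarymx by exact: spectral_unitarymx.
have uP : P \in unitmx by exact: spectral_unit.
have hk (k : 'I_n) : exists g : CC, G *m col k (invmx P) = g *: col k (invmx P) /\ normc g <= e.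
  have [||g h1 h2] := hG (D 0 k) (col k (invmx P)); last by exists g.
    apply/eqP => h0; have : P *m col k (invmx P) = 0 by rewrite h0 mulmx0.
    rewrite -col_mulmx mulmxV // => /colP /(_ k); rewrite !mxE eqxx => /eqP.
    by rewrite oner_eq0.
  have -> : A *m col k (invmx P) = col k (invmx P *m diag_mx D).
    by rewrite -col_mulmx {1}hA mulmxK.
  by apply/colP => l; rewrite !mxE (bigD1 k) //= big1 ?addr0 => [|m /negbTE hm];
    rewrite !mxE ?eqxx ?mulr1n ?hm ?mulr0n ?mulr0 // mulrC.
have [g hg] := fin_all_exists hk.
pose Dg : 'rV[CC]_n := \row_k g k.
have GP : G *m invmx P = invmx P *m diag_mx Dg.
  apply/matrixP => l k; have [/colP /(_ l) + _] := hg k.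
  rewrite -col_mulmx !mxE => ->; rewrite (bigD1 k) //= big1 ?addr0 => [|m /negbTE hm].
    by rewrite !mxE eqxx mulr1n mulrC.
  by rewrite !mxE hm mulr0n mulr0.
have -> : G = invmx P *m diag_mx Dg *m P by rewrite -GP mulmxKV.
have e0 : 0 <= e by have [_] := hg i; apply: le_trans; exact: normc_ge0.
(* The columns of the unitary P have norm 1; with |ab| <= (a^2 + b^2) / 2 this bounds the entry by
   e. *)
have row1 l : \sum_k normc (P k l) ^+ 2 = 1.
  have : (invmx P *m P) l l = 1 by rewrite mulVmx // mxE eqxx.
  rewrite invmx_unitary // mxE.
  rewrite (eq_bigr (fun k => (normc (P k l) ^+ 2)%:C)) => [|k _]; last first.
    by rewrite !mxE mulrC mul_conj_normc.
  by rewrite -rmorph_sum /= => /complexI.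
rewrite mxE; apply: le_trans (normc_sum _ _ _) _.
apply: (@le_trans _ _ (\sum_k e * ((normc (P k i) ^+ 2 + normc (P k j) ^+ 2) / 2))).
  apply: ler_sum => k _; rewrite mul_mx_diag !mxE invmx_unitary // !mxE !normcM normc_conj.
  have [_ gk] := hg k; rewrite mulrAC mulrC; apply: ler_pM => //; rewrite ?mulr_ge0 ?normc_ge0 //.
  have := sqr_ge0 (normc (P k i) - normc (P k j)); rewrite sqrrB; lra.
by rewrite -mulr_sumr -mulr_suml big_split /= !row1; lra.
Qed.

Lemma horner_mx_eigen n (A : 'M[CC]_n.+1) (v : 'cV_n.+1) (lam : CC) (q : {poly CC}) :
  A *m v = lam *: v -> horner_mx A q *m v = q.[lam] *: v.
Proof.
move=> hv; elim/poly_ind: q => [|q c IH].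
  by rewrite rmorph0 horner0 mul0mx scale0r.
rewrite rmorphD rmorphM /= horner_mx_X horner_mx_C hornerMXaddC mulmxDl.
rewrite -[_ * A]/(_ *m A) -mulmxA hv -scalemxAr IH mul_scalar_mx scalerA scalerDl.
by rewrite mulrC.
Qed.

Lemma horner_mx_entry0 n (A : 'M[CC]_n.+1) i j (q : {poly CC}) :
  (forall m, (m < size q)%N -> (A ^+ m) i j = 0) -> horner_mx A q i j = 0.
Proof.
move=> h; rewrite -[q]coefK poly_def raddf_sum summxE big1 // => m _.
by rewrite /= linearZ /= rmorphXn /= horner_mx_X mxE h // mulr0.
Qed.

(** * Coordinatewise limits and the exponential series on eigenvectors *)

Definition Ccv (u : nat -> CC) (l : CC) : Prop :=
  Un_cv (fun N => complex.Re (u N)) (complex.Re l) /\ Un_cv (fun N => complex.Im (u N)) (complex.Im l).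

Lemma Ccv_ext (u1 u2 : nat -> CC) l : (forall N, u1 N = u2 N) -> Ccv u1 l -> Ccv u2 l.
Proof. by move=> h [h1 h2]; split=> e he; [have [N hN] := h1 e he|have [N hN] := h2 e he]; exists N => n hn; rewrite -h; exact: hN. Qed.

Lemma Ccv_unique (u : nat -> CC) l1 l2 : Ccv u l1 -> Ccv u l2 -> l1 = l2.
Proof.
move=> [h1 h2] [h3 h4]; apply/eqP; rewrite eq_complex; apply/andP; split; apply/eqP.
  exact: UL_sequence h1 h3.
exact: UL_sequence h2 h4.
Qed.

Lemma Un_cv_cst x : Un_cv (fun=> x) x.
Proof. by move=> e he; exists 0%N => n _; rewrite /R_dist Rminus_diag Rabs_R0. Qed.

Lemma Ccv_cst l : Ccv (fun=> l) l.
Proof. by split; exact: Un_cv_cst. Qed.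

Lemma CcvD (u1 u2 : nat -> CC) l1 l2 : Ccv u1 l1 -> Ccv u2 l2 -> Ccv (fun N => u1 N + u2 N) (l1 + l2).
Proof.
move=> [h1 h2] [h3 h4]; split.
  have := CV_plus _ _ _ _ h1 h3; case: l1 l2 {h1 h2 h3 h4} => [a b] [c d] /=.
  by move=> h e he; have [N hN] := h e he; exists N => n /hN; case: (u1 n) (u2 n) => [? ?] [? ?].
have := CV_plus _ _ _ _ h2 h4; case: l1 l2 {h1 h2 h3 h4} => [a b] [c d] /=.
by move=> h e he; have [N hN] := h e he; exists N => n /hN; case: (u1 n) (u2 n) => [? ?] [? ?].
Qed.

Lemma CcvMl (u : nat -> CC) l z : Ccv u l -> Ccv (fun N => u N * z) (l * z).
Proof.
move=> [h1 h2]; have cst := Un_cv_cst; case: z => c d; split.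
  have := CV_minus _ _ _ _ (CV_mult _ _ _ _ h1 (cst c)) (CV_mult _ _ _ _ h2 (cst d)).
  case: l {h1 h2} => a b /= h e he.
  by have [N hN] := h e he; exists N => n /hN; case: (u n).
have := CV_plus _ _ _ _ (CV_mult _ _ _ _ h1 (cst d)) (CV_mult _ _ _ _ h2 (cst c)).
case: l {h1 h2} => a b /= h e he.
by have [N hN] := h e he; exists N => n /hN; case: (u n).
Qed.

Lemma Ccv_sum n (u : 'I_n -> nat -> CC) (l : 'I_n -> CC) :
  (forall k, Ccv (u k) (l k)) -> Ccv (fun N => \sum_k u k N) (\sum_k l k).
Proof.
elim: n u l => [|n IH] u l h.
  by rewrite big_ord0; apply: Ccv_ext (Ccv_cst 0) => N; rewrite big_ord0.
rewrite big_ord_recr /=; apply: Ccv_ext (CcvD (IH _ _ (fun k => h _)) (h ord_max)) => N.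
by rewrite big_ord_recr.
Qed.

Lemma Ccv_exp x : Ccv (fun N => \sum_(k < N.+1) (k`!%:R)^-1 * x%:C ^+ k) (exp x)%:C.
Proof.
have hx : Un_cv (fun N => \sum_(k < N.+1) (k`!%:R)^-1 * x ^+ k) (exp x).
  have : exp_in x (exp x) by rewrite /exp; case: exist_exp.
  move=> h e he; have [N hN] := h e he; exists N => n /hN.
  rewrite sum_f_R0E big_mkord; congr (Rlt (Rdist _ _) _).
  by apply: eq_bigr => k _; rewrite !RealsE.
have e1 N : \sum_(k < N.+1) (k`!%:R)^-1 * x%:C ^+ k
    = (\sum_(k < N.+1) (k`!%:R)^-1 * x ^+ k)%:C :> CC.
  by rewrite rmorph_sum /=; apply: eq_bigr => k _; rewrite rmorphM fmorphV rmorph_nat rmorphXn.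
split=> e he.
  by have [N hN] := hx e he; exists N => n /hN; rewrite e1.
by exists 0%N => n _; rewrite e1 /= /R_dist Rminus_diag Rabs_R0.
Qed.

(** The partial sums of the series applied to v converge entrywise to E v, and through the
    eigenvalue to e^x v; limits are unique. The eigenvalue is taken real, so that the real [exp]
    suffices. *)
Lemma expmx_eigen n (B E : 'M[CC]_n.+1) (v : 'cV_n.+1) x :
  (forall i j, Ccv (fun N => \sum_(k < N.+1) (k`!%:R)^-1 * (B ^+ k) i j) (E i j)) ->
  B *m v = x%:C *: v -> E *m v = (exp x)%:C *: v.
Proof.
move=> hE hv.
have hpow k : B ^+ k *m v = x%:C ^+ k *: v.
  by rewrite -[B]horner_mx_X -rmorphXn /= (horner_mx_eigen _ hv) hornerXn.
apply/colP => i; rewrite mxE [RHS]mxE.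
apply: (@Ccv_unique (fun N => \sum_l (\sum_(k < N.+1) (k`!%:R)^-1 * (B ^+ k) i l) * v l 0)).
  by apply: Ccv_sum => l; apply: CcvMl; exact: hE.
apply: Ccv_ext (CcvMl (v i 0) (Ccv_exp x)) => N.
rewrite mulr_suml; under [RHS]eq_bigr do rewrite mulr_suml.
rewrite exchange_big /=; apply: eq_bigr => k _.
have /colP /(_ i) := hpow k; rewrite mxE [RHS]mxE => h.
under eq_bigr do rewrite -mulrA.
by rewrite -mulr_sumr h mulrA.
Qed.

Lemma fermi_eigen n (B E F : 'M[CC]_n.+1) (v : 'cV_n.+1) x :
  (forall i j, Ccv (fun N => \sum_(k < N.+1) (k`!%:R)^-1 * (B ^+ k) i j) (E i j)) ->
  F *m (1%:M + E) = 1%:M -> B *m v = x%:C *: v -> F *m v = (1 + (exp x)%:C)^-1 *: v.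
Proof.
move=> hE hF hv; have hv' := expmx_eigen hE hv.
have n0 : 1 + (exp x)%:C != 0 :> CC.
  rewrite eq_complex /= negb_and; apply/orP; left; rewrite gt_eqF //.
  by have := exp_gt0 x; lra.
have : F *m ((1%:M + E) *m v) = v by rewrite mulmxA hF mul1mx.
rewrite mulmxDl mul1mx hv' -{1}[v]scale1r -scalerDl -scalemxAr => h.
by rewrite -{2}h scalerA mulVf // scale1r.
Qed.

(** * The Fermi function of a Hermitian matrix *)

Definition toC (z : Defs.C) : CC := Complex (re z) (im z).
Definition ofC (z : CC) : Defs.C := mkC (complex.Re z) (complex.Im z).

Lemma toCK (z : Defs.C) : ofC (toC z) = z.
Proof. by case: z. Qed.

Lemma ofCK (z : CC) : toC (ofC z) = z.
Proof. by case: z. Qed.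

Lemma toC_inj (z w : Defs.C) : toC z = toC w -> z = w.
Proof. by move=> h; rewrite -[z]toCK h toCK. Qed.

Lemma toC0 : toC C0 = 0. Proof. by []. Qed.

Lemma toC_RtoC x : toC (RtoC x) = x%:C. Proof. by []. Qed.

Lemma toCD (z w : Defs.C) : toC (Cadd z w) = toC z + toC w. Proof. by []. Qed.

Lemma toCM (z w : Defs.C) : toC (Cmul z w) = toC z * toC w. Proof. by []. Qed.

Lemma toCB (z w : Defs.C) : toC (Csub z w) = toC z - toC w. Proof. by []. Qed.

Lemma toC_exp (z : Defs.C) : toC (Cexp z) = cexp (toC z). Proof. by []. Qed.

Lemma toCV (z : Defs.C) : toC (Cinv z) = (toC z)^-1.
Proof.
rewrite /toC /Cinv; apply/eqP; rewrite eq_complex /= !RealsE !expr2.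
by apply/andP; split; apply/eqP => //; rewrite mulNr.
Qed.

Lemma toC_sum n (f : nat -> Defs.C) : toC (Csum n f) = \sum_(k < n) toC (f k).
Proof. by elim: n => [|n IH]; rewrite ?big_ord0 // big_ord_recr /= toCD IH. Qed.

Lemma CnormE (z : Defs.C) : Cnorm z = normc (toC z).
Proof. by rewrite /Cnorm RsqrtE !RealsE /= !expr2. Qed.

Definition tomx n (A : Mat) : 'M[CC]_n := \matrix_(i, j) toC (A i j).

Lemma tomx_mid n : tomx n mid = 1%:M.
Proof.
apply/matrixP => i j; rewrite !mxE /mid.
by case: PeanoNat.Nat.eqb_spec => [/val_inj ->|h]; rewrite ?eqxx //; case: eqP => // e; case: h; rewrite e.
Qed.

Lemma tomx_madd n A B : tomx n (madd A B) = tomx n A + tomx n B.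
Proof. by apply/matrixP => i j; rewrite !mxE. Qed.

Lemma tomx_msub n A B : tomx n (msub A B) = tomx n A - tomx n B.
Proof. by apply/matrixP => i j; rewrite !mxE. Qed.

Lemma tomx_mscale n a A : tomx n (mscale a A) = toC a *: tomx n A.
Proof. by apply/matrixP => i j; rewrite !mxE. Qed.

Lemma tomx_mmul n A B : tomx n (mmul n A B) = tomx n A *m tomx n B.
Proof.
apply/matrixP => i j; rewrite !mxE toC_sum; apply: eq_bigr => k _.
by rewrite toCM !mxE.
Qed.

Lemma tomx_mpow n A k : tomx n.+1 (mpow n.+1 A k) = tomx n.+1 A ^+ k.
Proof. by elim: k => [|k IH] /=; rewrite ?tomx_mid // tomx_mmul IH exprS. Qed.

Lemma tomx_meq n A B : meq n A B -> tomx n A = tomx n B.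
Proof. by move=> h; apply/matrixP => i j; rewrite !mxE h //; exact/ssrnat.ltP. Qed.

Lemma tomx_normal n A : Defs.hermitian n A -> tomx n A \is normalmx.
Proof.
move=> hA; have e : tomx n A = map_mx Num.conj (tomx n A)^T.
  apply/matrixP => i j; rewrite !mxE.
  by rewrite (hA i j (elimT ssrnat.ltP (ltn_ord i)) (elimT ssrnat.ltP (ltn_ord j))).
by apply/normalmxP; rewrite -e.
Qed.

Lemma tomx_eigenvalue n A (lam : CC) (v : 'cV_n.+1) : spectrum_in_m11 n.+1 A ->
  v != 0 -> tomx n.+1 A *m v = lam *: v -> exists2 x : R, lam = x%:C & -1 <= x <= 1.
Proof.
move=> hA v0 hv.
have /hA [him [/RleP h1 /RleP h2]] : Defs.eigenvalue n.+1 A (ofC lam).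
  (* [inord] extends the column vector to all naturals; only indices up to n are ever evaluated. *)
  exists (fun k => ofC (v (inord k) 0)); split.
    have [i hi] : exists i, v i 0 != 0.
      by apply/existsP; apply: contraNT v0; rewrite negb_exists => /forallP h;
        apply/eqP/colP => i; rewrite mxE; apply/eqP/negPn.
    exists i; split; first exact/ssrnat.ltP.
    rewrite inord_val => h; move: hi; rewrite -[v i 0]ofCK h toC0.
    by rewrite eqxx.
  move=> i /ssrnat.ltP hi; apply: toC_inj; rewrite toC_sum toCM !ofCK.
  have /colP /(_ (Ordinal hi)) := hv; rewrite !mxE => h.
  have -> : inord i = Ordinal hi by apply: val_inj; rewrite /= inordK.
  by rewrite -h; apply: eq_bigr => k _; rewrite toCM ofCK inord_val !mxE.
exists (complex.Re lam).
  by case: lam him {hv h1 h2} => a b /= ->.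
by rewrite -[X in X <= _](_ : IZR (-1) = _) ?h1.
Qed.

(** A nonzero product of entries along a sequence of indices traces a walk. Edges join distinct
    vertices, so diagonal factors stand still, and the walk may be shorter than m. *)
Lemma walk_of_power n A m (i j : 'I_n.+1) :
  (tomx n.+1 A ^+ m) i j != 0 -> exists2 k, (k <= m)%N & walk n.+1 A k i j.
Proof.
elim: m i => [|m IH] i.
  rewrite expr0 mxE; have [->|_] := eqVneq i j; last by rewrite eqxx.
  by exists 0%N => //; apply: walk0; apply/ssrnat.ltP.
rewrite exprS mxE => h.
have [l hl] : exists l, tomx n.+1 A i l * (tomx n.+1 A ^+ m) l j != 0.
  apply/existsP; apply: contraNT h; rewrite negb_exists => /forallP h.
  by rewrite big1 // => l _; apply/eqP/negPn.
move: hl; rewrite mulf_eq0 negb_or mxE => /andP [hil /IH [k km hk]].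
have [e|il] := eqVneq i l; first by exists k; [exact: leqW|rewrite e].
exists k.+1 => //; apply: walkS hk; split; first exact/ssrnat.ltP.
split; first exact/ssrnat.ltP.
split; first by move/val_inj => e; rewrite e eqxx in il.
by move=> e; rewrite e toC0 eqxx in hil.
Qed.

(** * The Fermi function on the ellipse and the segment *)

Definition fermi_fun (beta mu : R) (z : CC) : CC := (1 + cexp (beta%:C * (z - mu%:C)))^-1.

Lemma toC_fermi beta mu (z : Defs.C) : toC (fermi beta mu z) = fermi_fun beta mu (toC z).
Proof. by rewrite /fermi toCV toCD toC_exp toCM toCB. Qed.

Definition fermi_domain (chi : R) (z : CC) : Prop :=
  (exists t, z = ellipse_pt chi t) \/ (exists2 x : R, z = x%:C & -1 <= x <= 1).

Lemma fermi_domain_solid (chi : R) z : 1 < chi -> fermi_domain chi z ->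
  solid_ellipse chi (complex.Re z) (complex.Im z).
Proof.
move=> /RltP hc [[t ->]|[x -> /andP [/RleP x0 /RleP x1]]].
  have := ellipse_solid chi t hc; rewrite /semi_axis_x /semi_axis_y.
  by rewrite !RealsE.
by apply: segment_solid; last split; move: x0 x1; rewrite ?RealsE.
Qed.

Lemma fermi_domain_bounded (chi : R) z : 1 < chi -> fermi_domain chi z -> normc z <= chi.
Proof.
move=> hc [[t ->]|[x -> /andP [x0 x1]]]; last by rewrite normc_real ler_norml; lra.
have chi0 : 0 < chi by lra.
rewrite ellipse_ptE // normcM normcV normc_nat ler_pdivrMr //.
apply: le_trans (normcD _ _) _; rewrite normcV normcM normc_cis mulr1 normc_real gtr0_norm //.
have : chi^-1 <= 1 by rewrite invf_le1 // ltW.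
lra.
Qed.

Lemma papprox_fermi_domain (beta mu chi : R) : 0 < beta -> 1 < chi < chibar beta mu ->
  papprox (fermi_domain chi) (fermi_fun beta mu).
Proof.
move=> hb /andP [hc1 hc2]; move/RltP: (hb) => hb'; move/RltP: (hc1) => hc1'.
move/RltP: (hc2) => hc2'.
have [delta [/RltP d0 hdelta]] := one_plus_cexp_bounded_below beta mu chi hb' (conj hc1' hc2').
have bz : bounded_on (fermi_domain chi) (fun z => z - mu%:C) (chi + `|mu|).
  by move=> z hz; apply: le_trans (normcB _ _) _; rewrite normc_real lerD2r fermi_domain_bounded.
have bb : bounded_on (fermi_domain chi) (fun z => beta%:C) beta.
  by move=> z _; rewrite normc_real gtr0_norm.
apply: (@papprox_fermi _ (fun z => beta%:C * (z - mu%:C)) (beta * (chi + `|mu|)) (Num.sqrt delta)).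
- by rewrite sqrtr_gt0.
- by move=> z hz; rewrite normcM; apply: ler_pM; [exact: normc_ge0|exact: normc_ge0|exact: bb hz|exact: bz].
- apply: papproxM bb bz _ _.
    by apply: papprox_ext (papprox_poly _ (beta%:C)%:P) => z _; rewrite hornerC.
  by apply: papprox_ext (papprox_poly _ ('X - (mu%:C)%:P)) => z _; rewrite hornerXsubC.
move=> s z /andP [/RleP s0 /RleP s1] hz.
rewrite -(@ler_pXn2r _ 2) ?nnegrE ?normc_ge0 ?sqrtr_ge0 // sqr_sqrtr ?(ltW d0) //.
have hs : Rle 0 s /\ Rle s 1 by rewrite ?RealsE.
have /RleP := hdelta s _ _ hs (fermi_domain_solid hc1 hz).
have -> : s%:C * (beta%:C * (z - mu%:C))
    = Complex (s * (beta * (complex.Re z - mu))) (s * (beta * complex.Im z)).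
  case: z {hz} => a b; apply/eqP; rewrite eq_complex /=.
  by apply/andP; split; apply/eqP; ring.
rewrite normc_sqr /= !RealsE /= !expr2 => h.
by rewrite add0r; exact: h.
Qed.

(** * From polynomial approximation to the decay of matrix entries *)

Section Assembly.
Variables (n : nat) (A E F : Mat) (mu beta chi M : R).
Hypotheses (beta0 : 0 < beta) (hchi : 1 < chi < chibar beta mu).
Hypotheses (hA : Defs.hermitian n A) (sA : spectrum_in_m11 n A).
Hypothesis hE : is_mexp n (mscale (RtoC beta) (msub A (mscale (RtoC mu) mid))) E.
Hypothesis hF : is_minv n (madd mid E) F.
Hypothesis hM : forall t, normc (fermi_fun beta mu (ellipse_pt chi t)) <= M.

Lemma fermi_matrix_approx (q : {poly CC}) (e : R) (i j : nat) :
  (i < n)%N -> (j < n)%N ->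
  (forall x : R, -1 <= x <= 1 -> normc (fermi_fun beta mu x%:C - q.[x%:C]) <= e) ->
  (forall k m, (m < size q)%N -> (k <= m)%N -> ~ walk n A k i j) ->
  normc (toC (F i j)) <= e.
Proof.
(* Polynomials in a matrix need the ring of matrices of size n'.+1; size 0 leaves no index i. *)
move: hA sA hE hF => hA' sA' hE' hF'; case: n hA' sA' hE' hF' => // n' hA' sA' hE' hF' hi hj he hw.
pose io := Ordinal hi; pose jo := Ordinal hj.
set a := tomx n'.+1 A.
have q0 : horner_mx a q io jo = 0.
  apply: horner_mx_entry0 => m hm; apply/eqP; apply: contraT => /walk_of_power [k km wk].
  by case: (hw k m hm km).
have -> : toC (F i j) = (tomx n'.+1 F - horner_mx a q) io jo.
  by rewrite mxE [X in _ + X]mxE q0 subr0 mxE.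
apply: (normal_entry_bound (tomx_normal hA')) => lam v v0 hv.
have [x hx x1] := tomx_eigenvalue sA' v0 hv.
exists (fermi_fun beta mu x%:C - q.[x%:C]); last exact: he.
rewrite mulmxBl (horner_mx_eigen q hv) scalerBl hx; congr (_ - _).
pose B := beta%:C *: (a - mu%:C *: 1%:M).
have BE : tomx n'.+1 (mscale (RtoC beta) (msub A (mscale (RtoC mu) mid))) = B.
  by rewrite tomx_mscale tomx_msub tomx_mscale tomx_mid.
have hBv : B *m v = (beta * (x - mu))%:C *: v.
  rewrite -scalemxAl mulmxBl hv -scalemxAl mul1mx hx -scalerBl scalerA.
  by rewrite rmorphM rmorphB.
have hcv (k l : 'I_n'.+1) :
    Ccv (fun N => \sum_(m < N.+1) (m`!%:R)^-1 * (B ^+ m) k l) (tomx n'.+1 E k l).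
  have [h1 h2] := hE' k l (elimT ssrnat.ltP (ltn_ord k)) (elimT ssrnat.ltP (ltn_ord l)).
  have hlim : Ccv (fun N => toC (mexp_partial n'.+1
    (mscale (RtoC beta) (msub A (mscale (RtoC mu) mid))) N k l)) (toC (E k l)) by split.
  rewrite mxE; apply: Ccv_ext hlim => N.
  rewrite /mexp_partial toC_sum; apply: eq_bigr => m _.
  rewrite toCM toC_RtoC -BE -tomx_mpow mxE !RealsE.
  by rewrite fmorphV rmorph_nat.
have hF1 : tomx n'.+1 F *m (1%:M + tomx n'.+1 E) = 1%:M.
  have [_ /tomx_meq] := hF'; by rewrite tomx_mmul tomx_madd tomx_mid.
rewrite (fermi_eigen hcv hF1 hBv) /fermi_fun; congr ((1 + _)^-1 *: _).
rewrite -rmorphB -rmorphM /cexp /=.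
by apply/eqP; rewrite eq_complex /= cos_0 sin_0 mulr1 mulr0 !eqxx.
Qed.

Lemma fermi_entry_decay (i j d : nat) : (i < n)%N -> (j < n)%N -> (0 < d)%N ->
  (forall k, (k < d)%N -> ~ walk n A k i j) ->
  normc (toC (F i j)) <= 2 * chi * M / (chi - 1) * chi^-1 ^+ d.
Proof.
move=> hi hj d0 hw.
have /andP [hchi1 _] := hchi.
have chi0 : 0 < chi by lra.
pose kappa := 2 * chi / (chi - 1) * chi^-1 ^+ d.
have kappa0 : 0 <= kappa.
  by rewrite mulr_ge0 ?divr_ge0 ?exprn_ge0 ?invr_ge0 ?mulr_ge0 //; lra.
apply/ler_addgt0Pr => e e0.
(* On the ellipse p may exceed M by e', which costs kappa e' after truncation; another e' is lost
   between f and p. The total is e' (1 + kappa) = e. *)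
pose e' := e / (1 + kappa).
have e'0 : 0 < e' by rewrite divr_gt0 //; lra.
have [p hp] := papprox_fermi_domain beta0 hchi e'0.
have pM t : normc p.[ellipse_pt chi t] <= M + e'.
  have := hp (ellipse_pt chi t) (or_introl (ex_intro _ t erefl)).
  rewrite normcBC => h; rewrite -(subrK (fermi_fun beta mu (ellipse_pt chi t)) p.[_]).
  by apply: le_trans (normcD _ _) _; rewrite addrC; apply: lerD.
have [q sq hq] := bernstein hchi1 pM d0.
have err : 2 * chi * M / (chi - 1) * chi^-1 ^+ d + e
    = e' + 2 * chi * (M + e') / (chi - 1) * chi^-1 ^+ d.
  have -> : e = e' * (1 + kappa) by rewrite divfK // gt_eqF //; lra.
  by rewrite /kappa; field; rewrite !gt_eqF // subr_gt0.
rewrite err; apply: (fermi_matrix_approx (q := q) hi hj) => [x hx|].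
  have := hp x%:C (or_intror (ex_intro2 _ _ x erefl hx)); have := hq x hx.
  move=> h1 h2; rewrite -(subrKA p.[x%:C]).
  by apply: le_trans (normcD _ _) _; exact: lerD.
move=> k m mq km; apply: hw; exact: leq_ltn_trans km (leq_trans mq sq).
Qed.

(** Without any walk the degree is unrestricted: the approximating polynomial is used untruncated,
    and its arbitrarily small error bounds the entry. *)
Lemma fermi_entry_disconnected (i j : nat) : (i < n)%N -> (j < n)%N ->
  (forall k, ~ walk n A k i j) -> normc (toC (F i j)) <= 0.
Proof.
move=> hi hj hw; apply/ler_addgt0Pr => e e0; rewrite add0r.
have [p hp] := papprox_fermi_domain beta0 hchi e0.
apply: (fermi_matrix_approx hi hj) => [x hx|k m _ _]; last exact: hw.
by apply: (hp x%:C); right; exists x.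
Qed.

End Assembly.

Local Open Scope R_scope.

Lemma fermi_decay (n : nat) (A E F : Mat) (mu beta chi M : R) : 0 < beta ->
  1 < chi < chibar beta mu ->
  Defs.hermitian n A -> spectrum_in_m11 n A ->
  is_mexp n (mscale (RtoC beta) (msub A (mscale (RtoC mu) mid))) E ->
  is_minv n (madd mid E) F -> is_lub (fermi_mod_set beta mu chi) M ->
  forall i j : nat, (i < n)%coq_nat -> (j < n)%coq_nat -> i <> j ->
    (forall d, is_gdist n A i j d ->
      Cnorm (F i j) <= 2 * chi * M / (chi - 1) * exp (- ln chi * INR d)) /\
    (disconnected n A i j -> Cnorm (F i j) <= 0).
Proof.
move=> /RltP beta0 [/RltP chi1 /RltP chi2] hA sA hE hF [hM _] i j /ssrnat.ltP hi /ssrnat.ltP hj ij.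
have hchi : (1 < chi < chibar beta mu)%R by apply/andP.
have hM' t : (normc (fermi_fun beta mu (ellipse_pt chi t)) <= M)%R.
  apply/RleP; apply: hM; exists (ofC (ellipse_pt chi t)); split.
    by exists t; rewrite /ofC /= !RealsE.
  by rewrite CnormE toC_fermi ofCK.
split=> [d [wd hd]|hdis]; last first.
  by rewrite CnormE; apply/RleP; exact: (fermi_entry_disconnected beta0 hchi hA sA hE hF hi hj hdis).
(* A walk of length 0 ends where it starts, which i <> j excludes. *)
have d0 : (0 < d)%N.
  by rewrite lt0n; apply/eqP => e; rewrite e in wd; apply: ij; inversion wd.
have hexp : exp (- ln chi * INR d) = (chi^-1 ^+ d)%R.
  have chi0 : 0 < chi by apply/RltP; rewrite R0E; apply: lt_trans chi1; exact: ltr01.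
  rewrite -RinvE -[X in / X](exp_ln _ chi0) -exp_Ropp expRX.
  by rewrite !RealsE mulr_natr.
rewrite CnormE hexp; apply/RleP; rewrite !RealsE.
by apply: (fermi_entry_decay beta0 hchi hA sA hE hF hM' hi hj d0) => k /ssrnat.ltP; exact: hd.
Qed.

End PolynomialApproximation.

Theorem theorem8p2
  (H : nat -> Mat) (E F : nat -> Mat) (mu beta : R)
  (hbeta : 0 < beta)
  (hH : forall n, hermitian n (H n) /\ spectrum_in_m11 n (H n))
  (hE : forall n, is_mexp n (mscale (RtoC beta) (msub (H n) (mscale (RtoC mu) mid))) (E n))
  (hF : forall n, is_minv n (madd mid (E n)) (F n)) :
  forall chi : R, 1 < chi < chibar beta mu ->
  forall M : R, is_lub (fermi_mod_set beta mu chi) M ->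
  let c := 2 * chi * M / (chi - 1) in
  let theta := ln chi in
  forall n i j : nat, (i < n)%nat -> (j < n)%nat -> i <> j ->
    (forall d, is_gdist n (H n) i j d -> Cnorm (F n i j) <= c * exp (- theta * INR d)) /\
    (disconnected n (H n) i j -> Cnorm (F n i j) <= 0).
Proof.
intros chi hchi M hM c theta n.
destruct (hH n) as [hherm hspec].
exact (PolynomialApproximation.fermi_decay hbeta hchi hherm hspec (hE n) (hF n) hM).
Qed.
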